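(* Let $(M,\varphi_i,\xi_i,\eta_i,g)$, $i=1,2,3$, be a canonical almost $3$-contact metric manifold. Then: 1) The three tensors $N_{\varphi_i}$ ($i=1,2,3$) are skew-symmetric on $TM$ (i.e. $N_{\varphi_i}(X,Y,Z)=g(N_{\varphi_i}(X,Y),Z)$ is a $3$-form on $M$), and hence each almost contact metric structure $(\varphi_i,\xi_i,\eta_i,g)$ admits a characteristic connection $\nabla^i$. 2) Each almost contact metric structure $(\varphi,\xi,\eta,g)$ in the associated sphere $\Sigma_M$ admits a characteristic connection.
   Context: An almost contact metric structure $(\varphi,\xi,\eta,g)$ consists of a $(1,1)$-tensor field $\varphi$, a vector field $\xi$, a $1$-form $\eta$ and a Riemannian metric $g$ with $\varphi^2=-I+\eta\otimes\xi$, $\eta(\xi)=1$, $g(\varphi X,\varphi Y)=g(X,Y)-\eta(X)\eta(Y)$. Its fundamental form is $\Phi(X,Y)=g(X,\varphi Y)$, and $N_\varphi(X,Y)=[\varphi X,\varphi Y]+\varphi^2[X,Y]-\varphi[\varphi X,Y]-\varphi[X,\varphi Y]+d\eta(X,Y)\xi$, $N_\varphi(X,Y,Z)=g(N_\varphi(X,Y),Z)$. A characteristic connection of $(\varphi,\xi,\eta,g)$ is a metric connection $\nabla$ with skew torsion (i.e. $g(T(X,Y),Z)$ is a $3$-form) such that $\nabla\eta=0$ and $\nabla\varphi=0$. Known fact (Friedrich–Ivanov): it exists if and only if $N_\varphi$ is totally skew-symmetric and $\xi$ is Killing, and it is then unique. An almost $3$-contact metric manifold $(M,\varphi_i,\xi_i,\eta_i,g)$,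 $i=1,2,3$, is a manifold of dimension $4n+3$ with three almost contact metric structures with the same $g$ such that, for every even permutation $(i,j,k)$ of $(1,2,3)$, $\varphi_k=\varphi_i\varphi_j-\eta_j\otimes\xi_i=-\varphi_j\varphi_i+\eta_i\otimes\xi_j$, $\xi_k=\varphi_i\xi_j=-\varphi_j\xi_i$, $\eta_k=\eta_i\circ\varphi_j=-\eta_j\circ\varphi_i$. Set $\mathcal H=\bigcap_i\ker\eta_i$. The associated sphere $\Sigma_M$ consists of all almost contact metric structures $\varphi_a=\sum a_i\varphi_i$, $\xi_a=\sum a_i\xi_i$, $\eta_a=\sum a_i\eta_i$ with $a\in S^2\subset\mathbb R^3$ (and metric $g$). For $X,Y\in\Gamma(\mathcal H)$ let $A_{ij}(X,Y)=g((\mathcal L_{\xi_j}\varphi_i)X,Y)+d\eta_j(X,\varphi_iY)+d\eta_j(\varphi_iX,Y)$, $A_i=A_{ii}$. $M$ admits a Reeb Killing function $\beta\in C^\infty(M)$ if $A_i(X,Y)=0$ and $A_{ij}(X,Y)=-A_{ji}(X,Y)=\beta\Phi_k(X,Y)$ for all $X,Y\in\Gamma(\mathcal H)$ and every even permutation $(i,j,k)$ of $(1,2,3)$. $M$ is canonical if: 1) each $N_{\varphi_i}$ is skew-symmetric on $\mathcal H$ (i.e. $N_{\varphi_i}(X,Y,Z)$ restricted to $\mathcal H$ is a $3$-form); 2) each $\xi_i$ is Killing; 3) $N_{\varphi_i}(X,Y,Z)-d\Phi_i(\varphi_iX,\varphi_iY,\varphi_iZ)=N_{\varphi_j}(X,Y,Z)-d\Phi_j(\varphi_jX,\varphi_jY,\varphi_jZ)$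 for all $X,Y,Z\in\Gamma(\mathcal H)$ and all $i,j$; 4) $M$ admits a Reeb Killing function $\beta$. Conventions: $d\eta(X,Y)=X(\eta(Y))-Y(\eta(X))-\eta([X,Y])$, and analogously (no numerical factors) for forms of higher degree. *)

(* Defs.v *)
(* Smooth manifolds are Hausdorff second-countable spaces with a smooth atlas.
   On top of them we use the classical algebraic presentation of tensor
   calculus: C^oo(M) is a commutative ring, vector fields are the derivations
   of the real algebra C^oo(M), with the commutator as Lie bracket, and tensor
   fields are the C^oo(M)-multilinear maps on the module of vector fields. *)
From HB Require Import structures.
From mathcomp Require Import all_boot all_order all_algebra all_fingroup.
From mathcomp Require Import all_classical all_reals all_analysis.
From mathcomp Require Import ring.

Set Implicit Arguments.
Unset Strict Implicit.
Unset Printing Implicit Defensive.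

Import Order.TTheory GRing.Theory Num.Theory.
Import numFieldNormedType.Exports.

Local Open Scope classical_set_scope.
Local Open Scope ring_scope.

Section SmoothOn.
Context {R : realType} {d : nat}.
Implicit Types (U : set 'rV[R]_d) (f g : 'rV[R]_d -> R).

(* Meaningful for U open: the partial derivatives of f of order at most k exist
   and are continuous at all points of U. *)
Fixpoint Ck_on (k : nat) U f : Prop :=
  (forall x, U x -> {for x, continuous f}) /\
  (if k is k'.+1 then
     forall i : 'I_d, (forall x, U x -> derivable f x (delta_mx 0 i)) /\
       Ck_on k' U (fun x => 'D_(delta_mx 0 i) f x)
   else True).

Definition smooth_on U f : Prop := forall k, Ck_on k U f.

Lemma Ck_on_cont k U f x : Ck_on k U f -> U x -> {for x, continuous f}.
Proof. by case: k => [|k] [cf _] Ux; exact: cf. Qed.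

Lemma Ck_onW k U f : Ck_on k.+1 U f -> Ck_on k U f.
Proof.
elim: k f => [|k IH] f [cf Df]; first by split.
split=> // i; have [df Ddf] := Df i; split=> //; exact: IH.
Qed.

Lemma eq_Ck_on k U f g : open U -> (forall x, U x -> f x = g x) ->
  Ck_on k U f -> Ck_on k U g.
Proof.
move=> Uo; have nearU h h' (x : 'rV[R]_d) :
    (forall x, U x -> h x = h' x) -> U x -> \near x, (h x = h' x :> R).
  by move=> hh' Ux; apply: filterS hh' _; exact: open_nbhs_nbhs.
have cont (h h' : 'rV[R]_d -> R) x : (forall x, U x -> h x = h' x) -> U x ->
    {for x, continuous h} -> {for x, continuous h'}.
  move=> hh' Ux ch; have {}ch : h y @[y --> x] --> h' x by rewrite -hh'.
  apply: cvg_trans ch; apply: near_eq_cvg; first exact: nbhs_filter.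
  exact: nearU.
elim: k f g => [|k IH] f g fg [cf Df]; split=> //.
- by move=> x Ux; exact: cont fg Ux (cf _ Ux).
- by move=> x Ux; exact: cont fg Ux (cf _ Ux).
- move=> i; have [df Ddf] := Df i; split.
    by move=> x Ux; apply: near_eq_derivable (df _ Ux); exact: nearU.
  by apply: IH Ddf => x Ux; apply: near_eq_derive; exact: nearU.
Qed.

Lemma Ck_on_cst k U (a : R) : open U -> Ck_on k U (cst a).
Proof.
move=> Uo; elim: k a => [|k IH] a; split=> //.
- by move=> x _; exact: cst_continuous.
- by move=> x _; exact: cst_continuous.
- move=> i; split; first by move=> x _; exact: derivable_cst.
  by apply: eq_Ck_on (IH 0) => // x _; rewrite derive_cst.
Qed.

Lemma Ck_onD k U f g : open U -> Ck_on k U f -> Ck_on k U g ->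
  Ck_on k U (f + g).
Proof.
move=> Uo; elim: k f g => [|k IH] f g [cf Df] [cg Dg]; split=> //.
- by move=> x Ux; apply: continuousD; [exact: cf|exact: cg].
- by move=> x Ux; apply: continuousD; [exact: cf|exact: cg].
- move=> i; have [df Ddf] := Df i; have [dg Ddg] := Dg i; split.
    by move=> x Ux; apply: derivableD; [exact: df|exact: dg].
  by apply: eq_Ck_on (IH _ _ Ddf Ddg) => // x Ux; rewrite deriveD//; auto.
Qed.

Lemma Ck_onM k U f g : open U -> Ck_on k U f -> Ck_on k U g ->
  Ck_on k U (f * g).
Proof.
move=> Uo; elim: k f g => [|k IH] f g Cf Cg; (split; last first) => //.
- by move=> x Ux; apply: continuousM; [exact: Ck_on_cont Cf Ux|exact: Ck_on_cont Cg Ux].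
- move=> i; have [df Ddf] := Cf.2 i; have [dg Ddg] := Cg.2 i; split.
    by move=> x Ux; apply: derivableM; [exact: df|exact: dg].
  apply: (eq_Ck_on Uo _ (Ck_onD Uo (IH _ _ (Ck_onW Cf) Ddg)
                                   (IH _ _ (Ck_onW Cg) Ddf))) => x Ux.
  by rewrite deriveM//; auto.
- by move=> x Ux; apply: continuousM; [exact: Ck_on_cont Cf Ux|exact: Ck_on_cont Cg Ux].
Qed.

End SmoothOn.

(* A homeomorphism between open sets, extended arbitrarily to total functions. *)
Record chart (R : realType) (d : nat) (M : topologicalType) := Chart {
  chart_dom : set M ;
  chart_cod : set 'rV[R]_d ;
  chart_to :> M -> 'rV[R]_d ;
  chart_from : 'rV[R]_d -> M ;
  chart_dom_open : open chart_dom ;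
  chart_cod_open : open chart_cod ;
  chart_to_cod : forall p, chart_dom p -> chart_cod (chart_to p) ;
  chart_from_dom : forall x, chart_cod x -> chart_dom (chart_from x) ;
  chart_toK : forall p, chart_dom p -> chart_from (chart_to p) = p ;
  chart_fromK : forall x, chart_cod x -> chart_to (chart_from x) = x ;
  chart_to_cont : forall p, chart_dom p -> {for p, continuous chart_to} ;
  chart_from_cont : forall x, chart_cod x -> {for x, continuous chart_from} }.

(* The atlas need not be maximal: C^oo(M) only depends on the smooth structure
   which the atlas generates. *)
Record smoothManifold (R : realType) (d : nat) := SmoothManifold {
  carrier :> topologicalType ;
  manifold_hausdorff : hausdorff_space carrier ;
  manifold_second_countable : @second_countable carrier ;
  atlas : set (chart R d carrier) ;
  atlas_cover : forall p : carrier, exists2 c, atlas c & chart_dom c p ;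
  atlas_compat : forall c c', atlas c -> atlas c' -> forall i : 'I_d,
    smooth_on (chart_cod c `&` chart_from c @^-1` chart_dom c')
              (fun x => c' (chart_from c x) 0 i) }.

Section SmoothFunctions.
Context {R : realType} {d : nat} (M : smoothManifold R d).

Definition smooth_functions : {pred M -> R} :=
  mem [set f : M -> R | forall c, atlas c ->
                          smooth_on (chart_cod c) (f \o chart_from c)].

Record smoothFun := SmoothFun {
  smooth_val :> M -> R ;
  _ : smooth_val \in smooth_functions }.

HB.instance Definition _ := [isSub of smoothFun for smooth_val].
HB.instance Definition _ := [Choice of smoothFun by <:].

Lemma cst_smooth (a : R) : (cst a : M -> R) \in smooth_functions.
Proof.
by rewrite inE /= => c _ k; apply: Ck_on_cst; exact: chart_cod_open.
Qed.

Lemma smooth_functions_subring : subring_closed smooth_functions.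
Proof.
split; first exact: (cst_smooth 1).
- move=> f g; rewrite !inE /= => sf sg c ac k.
  have oc := @chart_cod_open _ _ _ c.
  apply: (eq_Ck_on oc _ (Ck_onD oc (sf c ac k)
    (Ck_onM oc (Ck_on_cst k (-1) oc) (sg c ac k)))) => x _.
  by rewrite [LHS]/(_ + -1 * _) mulN1r.
- move=> f g; rewrite !inE /= => sf sg c ac k.
  exact: Ck_onM (@chart_cod_open _ _ _ c) (sf c ac k) (sg c ac k).
Qed.

HB.instance Definition _ :=
  GRing.isSubringClosed.Build (M -> R) smooth_functions smooth_functions_subring.
HB.instance Definition _ := GRing.SubChoice_isSubComPzRing.Build (M -> R) smooth_functions smoothFun
    smooth_functions_subring.

Definition smooth_cst (a : R) : smoothFun := SmoothFun (cst_smooth a).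

Definition derivations : {pred smoothFun -> smoothFun^o} :=
  mem [set D : smoothFun -> smoothFun^o |
    [/\ forall f g, D (f + g) = D f + D g,
        forall (a : R) f, D (smooth_cst a * f) = smooth_cst a * D f &
        forall f g, D (f * g) = f * D g + g * D f]].

Record vectorField := VectorField {
  vector_val :> smoothFun -> smoothFun^o ;
  _ : vector_val \in derivations }.

HB.instance Definition _ := [isSub of vectorField for vector_val].
HB.instance Definition _ := [Choice of vectorField by <:].

Lemma derivations_submod : submod_closed derivations.
Proof.
split.
  rewrite inE /=; split=> *; rewrite ![(0 : smoothFun -> smoothFun^o) _]/(0).
  - by rewrite addr0.
  - by rewrite mulr0.
  - by rewrite !mulr0 addr0.
move=> h D E; rewrite !inE /= => -[DD DZ DM] [ED EZ EM].
have scE f : (h *: D + E) f = h * D f + E f by [].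
by split=> *; rewrite !scE ?(DD, DZ, DM, ED, EZ, EM); ring.
Qed.

HB.instance Definition _ :=
  GRing.isSubmodClosed.Build smoothFun (smoothFun -> smoothFun^o) derivations
    derivations_submod.
HB.instance Definition _ := [SubChoice_isSubLmodule of vectorField by <:].

Lemma lie_bracket_derivation (X Y : vectorField) :
  ((fun f => X (Y f) - Y (X f)) : smoothFun -> smoothFun^o) \in derivations.
Proof.
case: X => X /=; rewrite inE /= => -[XD XZ XM].
case: Y => Y /=; rewrite inE /= => -[YD YZ YM].
by rewrite inE /=; split=> *; rewrite ?(XD, YD, XZ, YZ, XM, YM); ring.
Qed.

Definition lie_bracket (X Y : vectorField) : vectorField :=
  VectorField (lie_bracket_derivation X Y).

End SmoothFunctions.

Section Tensors.
Context {R : realType} {d : nat} {M : smoothManifold R d}.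
Local Notation C := (smoothFun M).
Local Notation XM := (vectorField M).
Local Notation "[v X , Y ]" := (lie_bracket X Y) (at level 0).

Implicit Types (X Y Z : XM) (g : XM -> XM -> C) (eta : XM -> C).
Implicit Types (phi : XM -> XM).

(* At a point p, the tangent vector X_p vanishes iff X f vanishes at p for
   every smooth function f. *)
Record riemannian_metric g : Prop := RiemannianMetric {
  metric_sym : forall X Y, g X Y = g Y X ;
  metric_lin : forall (f : C) X X' Y, g (f *: X + X') Y = f * g X Y + g X' Y ;
  metric_pos : forall X (p : M), (exists f : C, (X f : C) p != 0) ->
    0 < g X X p }.

(* omega, restricted to the submodule of vector fields H, is a 3-form. *)
Record three_form_on (H : set XM) (omega : XM -> XM -> XM -> C) : Prop :=
  ThreeFormOn {
  form_lin1 : forall (f : C) X X' Y Z, H X -> H X' -> H Y -> H Z ->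
    omega (f *: X + X') Y Z = f * omega X Y Z + omega X' Y Z ;
  form_lin2 : forall (f : C) X Y Y' Z, H X -> H Y -> H Y' -> H Z ->
    omega X (f *: Y + Y') Z = f * omega X Y Z + omega X Y' Z ;
  form_lin3 : forall (f : C) X Y Z Z', H X -> H Y -> H Z -> H Z' ->
    omega X Y (f *: Z + Z') = f * omega X Y Z + omega X Y Z' ;
  form_skew12 : forall X Y Z, H X -> H Y -> H Z ->
    omega Y X Z = - omega X Y Z ;
  form_skew23 : forall X Y Z, H X -> H Y -> H Z ->
    omega X Z Y = - omega X Y Z }.

Definition three_form := three_form_on setT.

Definition ext_d1 eta (X Y : XM) : C :=
  X (eta Y) - Y (eta X) - eta [v X, Y].

Definition ext_d2 (omega : XM -> XM -> C) (X Y Z : XM) : C :=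
  X (omega Y Z) - Y (omega X Z) + Z (omega X Y)
  - omega [v X, Y] Z + omega [v X, Z] Y - omega [v Y, Z] X.

Definition lie_endo (X : XM) phi (Y : XM) : XM := [v X, phi Y] - phi [v X, Y].

Definition killing g (X : XM) : Prop := forall Y Z,
  X (g Y Z) = g [v X, Y] Z + g Y [v X, Z] :> C.

Record affine_connection (nabla : XM -> XM -> XM) : Prop := AffineConnection {
  conn_lin : forall (f : C) X X' Y,
    nabla (f *: X + X') Y = f *: nabla X Y + nabla X' Y ;
  conn_add : forall X Y Y', nabla X (Y + Y') = nabla X Y + nabla X Y' ;
  conn_leibniz : forall X (f : C) Y,
    nabla X (f *: Y) = (X f : C) *: Y + f *: nabla X Y }.

Definition torsion (nabla : XM -> XM -> XM) (X Y : XM) : XM :=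
  nabla X Y - nabla Y X - [v X, Y].

(* The data (phi, xi, eta); the axioms relating them to a metric are in
   almost_contact_metric below. *)
Record contactData := ContactData {
  cphi : XM -> XM ;
  cxi : XM ;
  ceta : XM -> C }.

Implicit Types (t : contactData) (s : 'I_3 -> contactData).

Record almost_contact_metric g t : Prop := AlmostContactMetric {
  acm_metric : riemannian_metric g ;
  acm_phi_lin : forall (f : C) X Y,
    cphi t (f *: X + Y) = f *: cphi t X + cphi t Y ;
  acm_eta_lin : forall (f : C) X Y,
    ceta t (f *: X + Y) = f * ceta t X + ceta t Y ;
  acm_phi2 : forall X, cphi t (cphi t X) = - X + ceta t X *: cxi t ;
  acm_eta_xi : ceta t (cxi t) = 1 ;
  acm_compat : forall X Y,
    g (cphi t X) (cphi t Y) = g X Y - ceta t X * ceta t Y }.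

Definition fundamental_form g t (X Y : XM) : C := g X (cphi t Y).

Definition nijenhuis t (X Y : XM) : XM :=
  [v cphi t X, cphi t Y] + cphi t (cphi t [v X, Y])
  - cphi t [v cphi t X, Y] - cphi t [v X, cphi t Y]
  + ext_d1 (ceta t) X Y *: cxi t.

Definition nijenhuis3 g t (X Y Z : XM) : C := g (nijenhuis t X Y) Z.

Record characteristic_connection g t (nabla : XM -> XM -> XM) : Prop :=
  CharacteristicConnection {
  char_affine : affine_connection nabla ;
  char_metric : forall X Y Z,
    X (g Y Z) = g (nabla X Y) Z + g Y (nabla X Z) :> C ;
  char_skew_torsion : three_form (fun X Y Z => g (torsion nabla X Y) Z) ;
  char_eta : forall X Y, X (ceta t Y) - ceta t (nabla X Y) = 0 :> C ;
  char_phi : forall X Y, nabla X (cphi t Y) - cphi t (nabla X Y) = 0 }.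

Definition admits_characteristic_connection g t : Prop :=
  exists nabla, characteristic_connection g t nabla.

(* (i, j, k) is an even permutation of (1, 2, 3), with indices shifted to
   (0, 1, 2). *)
Definition even_triple (i j k : 'I_3) : Prop :=
  exists2 sigma : 'S_3, ~~ odd_perm sigma &
    [/\ sigma 0 = i, sigma 1 = j & sigma 2%:R = k].

Record almost_3_contact_metric g s : Prop := Almost3ContactMetric {
  a3c_acm : forall i, almost_contact_metric g (s i) ;
  a3c_phi : forall i j k, even_triple i j k -> forall X,
    cphi (s k) X = cphi (s i) (cphi (s j) X) - ceta (s j) X *: cxi (s i) /\
    cphi (s k) X = - cphi (s j) (cphi (s i) X) + ceta (s i) X *: cxi (s j) ;
  a3c_xi : forall i j k, even_triple i j k ->
    cxi (s k) = cphi (s i) (cxi (s j)) /\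
    cxi (s k) = - cphi (s j) (cxi (s i)) ;
  a3c_eta : forall i j k, even_triple i j k -> forall X,
    ceta (s k) X = ceta (s i) (cphi (s j) X) /\
    ceta (s k) X = - ceta (s j) (cphi (s i) X) }.

Definition horizontal s : set XM := [set X | forall i, ceta (s i) X = 0].

Definition associated_sphere s : set contactData :=
  [set t | exists2 a : 'I_3 -> R, \sum_i a i ^+ 2 = 1 &
    t = ContactData (fun X => \sum_i smooth_cst M (a i) *: cphi (s i) X)
                    (\sum_i smooth_cst M (a i) *: cxi (s i))
                    (fun X => \sum_i smooth_cst M (a i) * ceta (s i) X)].

Definition A_tensor g s (i j : 'I_3) (X Y : XM) : C :=
  g (lie_endo (cxi (s j)) (cphi (s i)) X) Y
  + ext_d1 (ceta (s j)) X (cphi (s i) Y)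
  + ext_d1 (ceta (s j)) (cphi (s i) X) Y.

Definition reeb_killing_function g s (beta : C) : Prop :=
  forall X Y, horizontal s X -> horizontal s Y ->
    (forall i, A_tensor g s i i X Y = 0) /\
    (forall i j k, even_triple i j k ->
       A_tensor g s i j X Y = beta * fundamental_form g (s k) X Y /\
       - A_tensor g s j i X Y = beta * fundamental_form g (s k) X Y).

Record canonical_3_contact g s : Prop := Canonical3Contact {
  canonical_N_skew : forall i,
    three_form_on (horizontal s) (nijenhuis3 g (s i)) ;
  canonical_killing : forall i, killing g (cxi (s i)) ;
  canonical_N_dPhi : forall i j X Y Z,
    horizontal s X -> horizontal s Y -> horizontal s Z ->
    nijenhuis3 g (s i) X Y Z
      - ext_d2 (fundamental_form g (s i))
               (cphi (s i) X) (cphi (s i) Y) (cphi (s i) Z)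
    = nijenhuis3 g (s j) X Y Z
      - ext_d2 (fundamental_form g (s j))
               (cphi (s j) X) (cphi (s j) Y) (cphi (s j) Z) ;
  canonical_reeb_killing : exists beta, reeb_killing_function g s beta }.

End Tensors.

Arguments contactData {R d} M.

(* Main.v *)
(* The vertical distribution and the conditions on H determine one metric
   connection nabla with skew torsion T, where T(xi_i, ., .) = d eta_i +
   beta Phi_i and T = N_i - dPhi_i(phi_i ., phi_i ., phi_i .) on H (independent
   of i by the third canonical condition). It satisfies
     nabla_X xi_i = (beta/2) phi_i X,
     (nabla_X phi_i) Y = (beta/2) (eta_i(Y) X - g(X, Y) xi_i),
   the mixed components being the identities A_ii = 0 and A_ij = beta Phi_k.
   These equations are linear in the structure, so they hold on the whole
   associated sphere, and for each of its elements nabla becomes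
   characteristic once beta (eta /\ Phi) is subtracted from its torsion.
   Finally a characteristic connection with torsion T forces
     N(X, Y, Z) = T(X, Y, Z) - T(phi X, phi Y, Z) - T(phi X, Y, phi Z)
                  - T(X, phi Y, phi Z),
   which is totally skew.
   Connections come from Koszul's formula, which needs every C^oo(M)-linear
   form on derivations to be represented through g. By Hadamard's lemma, the
   derivations are spanned near each point by cut-off coordinate fields;
   Cramer's rule represents the form there up to a function delta. Local
   representatives divided by delta are unique, hence glue. *)
From HB Require Import structures.
Require Import Defs.
From mathcomp Require Import all_boot all_order all_algebra all_fingroup.
From mathcomp Require Import all_classical all_reals all_analysis.
From mathcomp Require Import ring.

Set Implicit Arguments.
Unset Strict Implicit.
Unset Printing Implicit Defensive.

Import Order.TTheory GRing.Theory Num.Theory.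
Import numFieldNormedType.Exports.

Local Open Scope classical_set_scope.
Local Open Scope ring_scope.

(** * Calculus of smooth functions on open sets *)

Section ChainRule.
Context {R : numFieldType}.

(** The two difference quotients coincide. This reduces directional derivatives to functions of one
    real variable, where the chain rule and the mean value theorem apply. *)
Lemma is_derive_line (V W : normedModType R) (f : V -> W) x v df :
  is_derive (0 : R) 1 (fun h => f (h *: v + x)) df <-> is_derive x v f df.
Proof.
have E : 'D_1 (fun h : R => f (h *: v + x)) 0 = 'D_v f x.
  apply: (congr1 (fun g : R -> W => lim (g @ 0^'))); apply/funext => h /=.
  by rewrite addr0 scale0r add0r [_%:A]mulr1.
split=> -[D Dv]; apply: DeriveDef.
- exact: (iffRL (derivable1P _ _ _)).
- exact: etrans (esym E) Dv.
- exact: (iffLR (derivable1P _ _ _)).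
- exact: etrans E Dv.
Qed.

Lemma is_derive_diff_comp (U V W : normedModType R) (g : U -> V) (f : V -> W)
    x v dg :
  is_derive x v g dg -> differentiable f (g x) ->
  is_derive x v (f \o g) ('d f (g x) dg).
Proof.
move=> /is_derive_line; set c := (fun h : R => _) => -[gd gv] df.
apply/is_derive_line; move: gd => /derivable1_diffP gd.
have c0 : c 0 = g x by rewrite /c scale0r add0r.
have fd : differentiable f (c 0) by rewrite c0.
have -> : (fun h : R => (f \o g) (h *: v + x)) = f \o c by [].
have cd : differentiable (f \o c) 0 by exact: differentiable_comp.
apply: DeriveDef; first exact/derivable1_diffP.
by rewrite deriveE // (@diff_comp _ _ _ _ c f) //= -gv deriveE // c0.
Qed.

Lemma is_derive_comp1 (V W : normedModType R) (g : V -> R) (f : R -> W)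
    x v dg df :
  is_derive x v g dg -> is_derive (g x) 1 f df ->
  is_derive x v (f \o g) (dg *: df).
Proof.
move=> gD [fd <-]; have fD : differentiable f (g x) by exact/derivable1_diffP.
have := is_derive_diff_comp gD fD.
by rewrite deriv1E// derive1E.
Qed.

End ChainRule.

Section SmoothCalculus.
Context {R : realType} {d : nat}.
Local Notation V := 'rV[R]_d.
Local Notation e i := (delta_mx 0 i : V).
Implicit Types (U W : set V) (f g : V -> R).

Lemma row_normr_le (x : V) r : 0 <= r ->
  (`|x| <= r) <-> (forall i, `|x 0 i| <= r).
Proof.
move=> r0; rewrite [leLHS]/Num.Def.normr/= mx_normrE; split.
  move=> /bigmax_leP[_ H] i; exact: (H (0, i)).
by move=> H; apply: bigmax_le => //= -[i j] _; rewrite (ord1 i).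
Qed.

Lemma coord_normr_le (x : V) i : `|x 0 i| <= `|x|.
Proof. by apply: (row_normr_le x (normr_ge0 x)).1. Qed.

Lemma Ck_on_sub k U W f : W `<=` U -> Ck_on k U f -> Ck_on k W f.
Proof.
move=> WU; elim: k f => [|k IH] f [cf Df]; split=> //.
- by move=> x /WU; exact: cf.
- by move=> x /WU; exact: cf.
- move=> i; have [df Ddf] := Df i; split; first by move=> x /WU; exact: df.
  exact: IH.
Qed.

(** Openness of W is not asked, because [Ck_on] only speaks of derivatives of the total function at
    points of the set. *)
Lemma Ck_on_local k U f :
  (forall x, U x -> exists2 W, W x & Ck_on k W f) -> Ck_on k U f.
Proof.
elim: k f => [|k IH] f loc; split=> //.
- by move=> x /loc[W Wx [cf _]]; exact: cf.
- by move=> x /loc[W Wx [cf _]]; exact: cf.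
- move=> i; split.
    by move=> x /loc[W Wx [_ /(_ i)[df _]]]; exact: df.
  by apply: IH => x /loc[W Wx [_ /(_ i)[_ Df]]]; exists W.
Qed.

Lemma Ck_on_derive i k U f : Ck_on k.+1 U f -> Ck_on k U (fun x => 'D_(e i) f x).
Proof. by move=> [_ /(_ i)[]]. Qed.

Lemma Ck_on_derivable i k U f x : Ck_on k.+1 U f -> U x -> derivable f x (e i).
Proof. by move=> [_ /(_ i)[df _]]; exact: df. Qed.

#[global] Arguments Ck_on_derive i {k U f}.
#[global] Arguments Ck_on_derivable i {k U f x}.

Lemma Ck_on_sum k U (I : Type) (r : seq I) (P : pred I) (F : I -> V -> R) :
  open U -> (forall i, P i -> Ck_on k U (F i)) ->
  Ck_on k U (fun x => \sum_(i <- r | P i) F i x).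
Proof.
move=> Uo CF; rewrite (_ : (fun _ => _) = \sum_(i <- r | P i) F i); last first.
  by apply/funext => x; rewrite fct_sumE.
by apply: big_ind => //; [exact: Ck_on_cst|move=> *; exact: Ck_onD].
Qed.

Lemma Ck_on_prod k U (I : Type) (r : seq I) (P : pred I) (F : I -> V -> R) :
  open U -> (forall i, P i -> Ck_on k U (F i)) ->
  Ck_on k U (fun x => \prod_(i <- r | P i) F i x).
Proof.
move=> Uo CF; rewrite (_ : (fun _ => _) = \prod_(i <- r | P i) F i); last first.
  by apply/funext => x; rewrite fct_prodE.
by apply: big_ind => //; [exact: Ck_on_cst|move=> *; exact: Ck_onM].
Qed.

Lemma Ck_onN k U f : open U -> Ck_on k U f -> Ck_on k U (- f).
Proof.
move=> Uo Cf; rewrite (_ : - f = cst (-1) * f); last first.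
  by apply/funext => x; exact: (esym (mulN1r (f x))).
exact: Ck_onM (Ck_on_cst _ _ _) _.
Qed.

Lemma Ck_onB k U f g : open U -> Ck_on k U f -> Ck_on k U g -> Ck_on k U (f - g).
Proof. by move=> Uo Cf Cg; apply: Ck_onD => //; exact: Ck_onN. Qed.

Lemma is_derive_coord (x v : V) i : is_derive x v (fun y : V => y 0 i) (v 0 i).
Proof.
have dx := @differentiable_coord R _ _ x 0 i.
apply: DeriveDef; first exact: diff_derivable.
apply/lim_near_cst => //; near=> h; rewrite /= !mxE addrK.
have h0 : h != 0 by near: h; exact: nbhs_dnbhs_neq.
by rewrite [LHS]mulKf.
Unshelve. all: by end_near. Qed.

Lemma Ck_on_coord k U i : open U -> Ck_on k U (fun y : V => y 0 i).
Proof.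
move=> Uo.
have cc : forall x : V, {for x, continuous (fun y : V => y 0 i)}.
  by move=> x; exact: (coord_continuous (i := 0)).
case: k => [|k]; split=> // j; split.
  by move=> x _; exact: (@ex_derive _ _ _ _ _ _ _ (is_derive_coord x _ i)).
apply: eq_Ck_on (Ck_on_cst k ((e j) 0 i) Uo) => // x _.
by rewrite (@derive_val _ _ _ _ _ _ _ (is_derive_coord x _ i)).
Qed.

Lemma Ck_on_inv k U f : open U -> Ck_on k U f -> (forall x, U x -> f x != 0) ->
  Ck_on k U (fun x => (f x)^-1).
Proof.
move=> Uo + f0; elim: k => [|k IH] Cf; (split; last first) => //.
- by move=> x Ux; apply: continuousV; [exact: f0|exact: Ck_on_cont Cf Ux].
- move=> i; have CfV := IH (Ck_onW Cf); split.
    by move=> x Ux; apply: derivableV; [exact: f0|exact: Ck_on_derivable Cf Ux].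
  apply: (eq_Ck_on Uo _ (Ck_onN Uo (Ck_onM Uo (Ck_onM Uo CfV CfV)
    (Ck_on_derive i Cf)))) => x Ux.
  rewrite deriveV; [|exact: f0|exact: Ck_on_derivable Cf Ux].
  by rewrite expr2 invfM [RHS]mulNr.
- by move=> x Ux; apply: continuousV; [exact: f0|exact: Ck_on_cont Cf Ux].
Qed.

(** The one-variable mean value theorem along a segment parallel to an axis. It serves both the
    total increment estimate and differentiation under the integral sign. *)
Lemma Ck_on_MVT U f (z : V) i (c : R) : open U -> Ck_on 1 U f ->
  (forall t, 0 <= t <= 1 -> U (z + t *: (c *: e i))) ->
  exists2 t, 0 <= t <= 1 &
    f (z + c *: e i) - f z = c * 'D_(e i) f (z + t *: (c *: e i)).
Proof.
move=> Uo Cf Uz; pose y (t : R) := z + t *: (c *: e i).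
have yd (t : R) : 0 <= t <= 1 ->
    is_derive t 1 (f \o y) (c * 'D_(e i) f (y t)).
  move=> t01; have df := Ck_on_derivable i Cf (Uz t t01).
  have -> : f \o y = (fun s => f (s *: e i + y t)) \o (fun s => c * (s - t)).
    apply/funext => s /=; rewrite /y; congr f; apply/rowP => j.
    rewrite !mxE; ring.
  have -> : c * 'D_(e i) f (y t) = c *: 'D_(e i) f (y t) by [].
  apply: is_derive_comp1; first by apply: is_derive_eq; rewrite subr0 [LHS]mulr1.
  by rewrite subrr mulr0; apply/is_derive_line; exact: derivableP.
have yd' (t : R) : t \in `]0, 1[%R ->
    is_derive t 1 (f \o y) (c * 'D_(e i) f (y t)).
  by rewrite in_itv/= => /andP[t0 t1]; apply: yd; rewrite (ltW t0) (ltW t1).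
have yc : {within `[0, 1], continuous (f \o y)}.
  apply: derivable_within_continuous => t; rewrite in_itv/= => t01.
  exact: (@ex_derive _ _ _ _ _ _ _ (yd t t01)).
have [t] := MVT_segment ler01 yd' yc; rewrite in_itv/= => t01.
by rewrite /= /y scale1r scale0r addr0 subr0 mulr1 => E; exists t.
Qed.

(* The increment over h is split along the coordinate axes; the mean value
   theorem is applied on each step. *)
Lemma Ck_on_increment U f x (eps : R) : open U -> Ck_on 1 U f -> U x -> 0 < eps ->
  \forall h \near (0 : V),
    `|f (x + h) - f x - \sum_i h 0 i * 'D_(e i) f x| <= eps * `|h|.
Proof.
move=> Uo Cf Ux eps0.
(* Each of the d steps may cost eps'; dividing by d + 1 keeps eps' positive when d = 0. *)
pose eps' := eps / d.+1%:R.
have eps'0 : 0 < eps' by rewrite divr_gt0.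
pose P i (h : V) := U (x + h) /\ `|'D_(e i) f (x + h) - 'D_(e i) f x| <= eps'.
have Ucont i : \forall h \near (0 : V), P i h.
  have cD : {for x, continuous (fun y => 'D_(e i) f y)}.
    exact: Ck_on_cont (Ck_on_derive i Cf) Ux.
  have : \forall y \near x, U y /\ `|'D_(e i) f y - 'D_(e i) f x| <= eps'.
    near=> y; split; first by near: y; exact: open_nbhs_nbhs.
    by rewrite distrC; near: y; move/cvgrPdist_le : cD; apply.
  by move=> /nbhs0P.
have : \forall h \near (0 : V), forall i, P i h.
  exact: (@filter_forall _ _ P _ (nbhs_filter _) Ucont).
(* Membership in U is extracted from the family [P] at some index, so the zero-dimensional case,
   where every increment vanishes, is treated apart. *)
case: (posnP d) => [d0 _|d0].
  have no (i : 'I_d) : False by case: i => i; rewrite d0.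
  near=> h; have -> : h = 0 by apply/rowP => i; case: (no i).
  by rewrite addr0 subrr sub0r big1 ?oppr0 ?normr0 ?mulr0// => i; case: (no i).
move=> /nbhs_ballP[r /= r0 br]; near=> h.
have hr : `|h| < r by near: h; apply/nbhs_ballP; exists r => //= y;
    rewrite -ball_normE /= sub0r normrN.
(* [hh k] keeps the first k coordinates of h. The norm is the maximum norm, so all intermediate
   points stay in the ball of radius r. *)
pose hh k : V := \row_i (if (i < k)%N then h 0 i else 0).
have small (y : V) : (forall i, `|y 0 i| <= `|h|) -> 
   U (x + y) /\ forall i, `|'D_(e i) f (x + y) - 'D_(e i) f x| <= eps'.
  move=> yh; have : ball 0 r y.
    rewrite -ball_normE /= sub0r normrN; apply: le_lt_trans hr.
    exact/row_normr_le.
  move=> /br H; split=> [|i]; last by have [] := H i.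
  by have [] := H (Ordinal d0).
have step (k : 'I_d) : `|f (x + hh k.+1) - f (x + hh k) - h 0 k * 'D_(e k) f x|
    <= eps' * `|h|.
  pose y (t : R) := hh k + t *: (h 0 k *: e k).
  have ysmall (t : R) : 0 <= t <= 1 -> forall i, `|y t 0 i| <= `|h|.
    move=> /andP[t0 t1] i; rewrite !mxE eqxx /=.
    have [->|ik] := eqVneq i k.
      rewrite ltnn add0r mulr1 normrM ger0_norm//.
      by apply: le_trans (coord_normr_le h k); rewrite ler_piMl.
    rewrite !mulr0 addr0; by case: ifP => // _; rewrite ?normr0 ?coord_normr_le.
  have Uy (t : R) : 0 <= t <= 1 -> U (x + hh k + t *: (h 0 k *: e k)).
    by move=> t01; have [] := small _ (ysmall t t01); rewrite /y addrA.
  have -> : x + hh k.+1 = x + hh k + h 0 k *: e k.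
    rewrite -addrA; congr (_ + _); apply/rowP => i; rewrite !mxE eqxx /= ltnS.
    have [->|ik] := eqVneq i k; first by rewrite leqnn ltnn add0r mulr1.
    have ik' : (i == k :> nat) = false by exact: negbTE.
    by rewrite !mulr0 addr0 leq_eqVlt ik'.
  have [t t01 ->] := Ck_on_MVT Uo Cf Uy.
  rewrite -addrA -/(y t) -mulrBr normrM mulrC ler_pM//.
  - by have [_ /(_ k)] := small _ (ysmall t t01).
  - exact: coord_normr_le.
have hh0 : hh 0 = 0 by apply/rowP => i; rewrite !mxE.
have hhd : hh d = h by apply/rowP => i; rewrite !mxE ltn_ord.
have -> : f (x + h) - f x = \sum_(k < d) (f (x + hh k.+1) - f (x + hh k)).
  rewrite -(big_mkord xpredT (fun k => f (x + hh k.+1) - f (x + hh k))).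
  by rewrite telescope_sumr// hh0 hhd addr0.
rewrite -sumrB (le_trans (ler_norm_sum _ _ _))//.
apply: (le_trans (ler_sum _ (fun k _ => step k))).
rewrite sumr_const card_ord -mulr_natr mulrAC ler_wpM2r//.
by rewrite /eps' mulrAC ler_pdivrMr// ler_pM2l// ler_nat.
Unshelve. all: by end_near. Qed.

(** By the increment estimate, f(x + h) - f(x) - L h is o(h) for the continuous linear map L below,
    and differentials are unique. *)
Lemma Ck_on_diff U f x : open U -> Ck_on 1 U f -> U x ->
  differentiable f x /\ forall v, 'd f x v = \sum_i v 0 i * 'D_(e i) f x.
Proof.
move=> Uo Cf Ux.
pose L (v : V) : R := \sum_i v 0 i * 'D_(e i) f x.
have Ll : linear L.
  move=> a u v; rewrite /L scaler_sumr -big_split /=; apply: eq_bigr => i _.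
  by rewrite !mxE mulrDl -mulrA.
pose LM := GRing.isLinear.Build _ _ _ _ _ Ll.
pose Lf : {linear V -> R} := HB.pack L LM.
have Lc : continuous Lf.
  have CL : Ck_on 0 setT L.
    apply: Ck_on_sum => [|i _]; first exact: openT.
    by apply: Ck_onM; [exact: openT|apply: Ck_on_coord|apply: Ck_on_cst];
      exact: openT.
  by move=> v; exact: Ck_on_cont CL I.
have E h : f (h + x) - (f x + L h) = f (x + h) - f x - L h.
  by rewrite opprD addrA (addrC h).
have dE : 'd f x = Lf :> (V -> R).
  apply: diff_unique => //; apply/eqaddoP => eps eps0.
  have := Ck_on_increment Uo Cf Ux eps0; apply: filterS => h /=.
  by rewrite -/(L h) -E.
split; last by move=> v; rewrite dE.
apply/diff_locallyP; rewrite dE; split=> //; apply/eqaddoP => eps eps0.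
have := Ck_on_increment Uo Cf Ux eps0; apply: filterS => h /=.
by rewrite -/(L h) -E.
Qed.

Lemma is_derive_Ck_on_comp U f (E : normedModType R) (g : E -> V) x v dg :
  open U -> Ck_on 1 U f -> U (g x) ->
  (forall i, is_derive x v (fun y => g y 0 i) (dg i)) ->
  is_derive x v (f \o g) (\sum_i dg i * 'D_(e i) f (g x)).
Proof.
move=> Uo Cf Ugx gD; have [df dfE] := Ck_on_diff Uo Cf Ugx.
have gd : derivable g x v.
  apply/derivable_mxP => i j; rewrite (ord1 i).
  exact: (@ex_derive _ _ _ _ _ _ _ (gD j)).
have := is_derive_diff_comp (derivableP gd) df; rewrite dfE derive_mx//.
congr is_derive; apply: eq_bigr => i _; rewrite mxE.
by rewrite (@derive_val _ _ _ _ _ _ _ (gD i)).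
Qed.

(** Induction on k: by the chain rule a partial derivative of f o g is a sum of products whose
    factors are partial derivatives of g and compositions of partial derivatives of f with g. *)
Lemma Ck_on_comp k U W f (g : V -> V) : open U -> open W ->
  (forall x, W x -> U (g x)) ->
  Ck_on k U f -> (forall i, Ck_on k W (fun x => g x 0 i)) ->
  Ck_on k W (f \o g).
Proof.
move=> Uo Wo gU Cf Cg.
have gc x : W x -> {for x, continuous g}.
  move=> Wx; apply/(@cvgrPdist_le _ _ _ (nbhs x) (nbhs_filter x)) => eps eps0.
  near=> y.
  apply/row_normr_le; first exact: ltW.
  move=> j; rewrite !mxE; move: j; near: y.
  apply: (@filter_forall _ _ (fun j y => `|g x 0 j - g y 0 j| <= eps) _
    (nbhs_filter _)) => j.
  by have := Ck_on_cont (Cg j) Wx; move/cvgrPdist_le; apply.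
elim: k f Cf Cg => [|k IH] f Cf Cg; (split; last first) => //.
- move=> x Wx; apply: continuous_comp; first exact: gc.
  by apply: Ck_on_cont Cf _; exact: gU.
- move=> i.
  have C1 : Ck_on 1 U f by elim: (k) Cf => // k' IHk /Ck_onW.
  have D x : W x -> is_derive x (e i) (f \o g)
      (\sum_j 'D_(e i) (fun y => g y 0 j) x * 'D_(e j) f (g x)).
    move=> Wx; apply: (is_derive_Ck_on_comp Uo C1 (gU _ Wx)) => j.
    by apply: derivableP; exact: Ck_on_derivable (Cg j) Wx.
  split; first by move=> x /D[].
  apply: (eq_Ck_on Wo (f :=
    fun x => \sum_j 'D_(e i) (fun y => g y 0 j) x * 'D_(e j) f (g x))).
    by move=> x /D[].
  apply: Ck_on_sum => // j _.
  apply: Ck_onM => //; first exact: Ck_on_derive (Cg j).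
  apply: (IH (fun y => 'D_(e j) f y)); first exact: Ck_on_derive.
  by move=> l; exact: Ck_onW.
- move=> x Wx; apply: continuous_comp; first exact: gc.
  by apply: Ck_on_cont Cf _; exact: gU.
Unshelve. all: by end_near. Qed.

End SmoothCalculus.

(** * A smooth function vanishing on the negative half-line *)

Section FlatFunction.
Context {R : realType}.

(** [flat 0] is the usual exp(-1/s). The powers of 1/s make the family stable under differentiation:
    the derivative of [flat m] is a combination of [flat m.+2] and [flat m.+1]. *)
Definition flat m (s : R) : R := if 0 < s then s^-1 ^+ m * expR (- s^-1) else 0.

Lemma flat_gt0 m s : 0 < s -> 0 < flat m s.
Proof. by move=> s0; rewrite /flat s0 mulr_gt0 ?expR_gt0// exprn_gt0// invr_gt0. Qed.

Lemma flat_le0 m s : s <= 0 -> flat m s = 0.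
Proof. by rewrite /flat ltNge => ->. Qed.

(** Follows from exp(x) >= x^(m+2) / (m+2)! at x = 1/s. A quadratic bound suffices to make the
    derivative at 0 vanish. *)
Lemma flat_bound m (s : R) : `|flat m s| <= m.+2`!%:R * s ^+ 2.
Proof.
have [s0|s0] := ltP 0 s; last first.
  by rewrite flat_le0// normr0 mulr_ge0// sqr_ge0.
rewrite gtr0_norm ?flat_gt0// /flat s0 expRN.
have t0 : 0 < s^-1 by rewrite invr_gt0.
have := @expR_ge1Dxn R s^-1 m.+1 (ltW t0).
set E := expR _ => HE.
have E0 : 0 < E by exact: expR_gt0.
have f0 : 0 < m.+2`!%:R :> R by rewrite ltr0n fact_gt0.
rewrite ler_pdivrMr//.
have : s^-1 ^+ m.+2 / m.+2`!%:R <= E by apply: le_trans HE; rewrite lerDr.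
rewrite ler_pdivrMr// => H.
have -> : s^-1 ^+ m = s^-1 ^+ m.+2 * s ^+ 2.
  by rewrite -addn2 exprD -mulrA -exprMn mulVf ?gt_eqF// expr1n mulr1.
by rewrite [leRHS]mulrAC ler_wpM2r ?sqr_ge0// mulrC.
Qed.

Lemma is_derive_flat m (s : R) :
  is_derive s 1 (flat m) (flat m.+2 s - m%:R * flat m.+1 s).
Proof.
have [s0|s0|s0] := ltgtP s 0.
- rewrite !flat_le0 ?ltW// mulr0 subr0.
  have /near_eq_is_derive : \near s, cst 0 s = flat m s.
    near=> t; rewrite flat_le0//; near: t.
    by apply: filterS (lt_nbhsl s0) => t /ltW.
  by apply; exact: is_derive_cst.
(* For s > 0, [flat m] is G composed with inversion. *)
- pose G (t : R) := t ^+ m * expR (- t).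
  have DG (t : R) : is_derive t 1 G (m%:R * t ^+ m.-1 * expR (- t) - t ^+ m * expR (- t)).
    have DN : is_derive t 1 (expR \o -%R) (- 1 *: expR (- t)).
      exact: is_derive_comp1.
    have DX : is_derive t 1 (id ^+ m : R -> R) ((m%:R * t ^+ m.-1) *: 1).
      exact: is_deriveX.
    have := is_deriveM DX DN.
    have -> : (id ^+ m * (expR \o -%R)) = G.
      by apply/funext => u; rewrite /G fctE exprfctE.
    move=> D; apply: is_derive_eq.
    rewrite exprfctE /= /GRing.scale /=; ring.
  have DI : is_derive s 1 (fun x : R => x^-1) (- s ^- 2).
    have sn0 : s != 0 by rewrite gt_eqF.
    apply: DeriveDef; first exact: (@derivableV _ _ (@id R)).
    by rewrite (@deriveV _ _ (@id R))// derive_id [LHS]mulr1.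
  have := is_derive_comp1 DI (DG s^-1).
  set v := (X in is_derive _ _ _ X) => D.
  have -> : flat m.+2 s - m%:R * flat m.+1 s = v.
    rewrite /v /flat s0 /GRing.scale /= -exprVn.
    case: m {G DG D v} => [|m]; rewrite /= ?exprS; ring.
  apply: near_eq_is_derive D; near=> t.
  rewrite /flat ifT//; near: t; exact: lt_nbhsr.
(* At the origin the difference quotient is at most (m+2)! |h|. *)
- rewrite s0 !flat_le0// mulr0 subr0.
  have D : h^-1 *: (flat m (h *: 1 + 0) - flat m 0) @[h --> 0^'] --> (0 : R).
    apply/cvgr0Pnorm_le => eps eps0; near=> h.
    rewrite [h *: 1]mulr1 addr0 (flat_le0 _ (lexx 0)) subr0 normrM normfV.
    have h0 : h != 0 by near: h; exact: nbhs_dnbhs_neq.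
    rewrite ler_pdivrMl ?normr_gt0// (le_trans (flat_bound m h))//.
    rewrite -normr_id -real_normK ?num_real// normr_id expr2 mulrA mulrC.
    rewrite ler_wpM2l//.
    rewrite -ler_pdivlMl ?ltr0n ?fact_gt0//.
    near: h; apply: dnbhs0_le.
    by rewrite mulr_gt0// invr_gt0 ltr0n fact_gt0.
  by apply: DeriveDef; [apply/cvg_ex; exists 0|exact: cvg_lim D].
Unshelve. all: by end_near. Qed.

(** The induction on k is for all m at once, since differentiation raises m. *)
Lemma Ck_on_flat d k (U : set 'rV[R]_d) (u : 'rV[R]_d -> R) m : open U ->
  Ck_on k U u -> Ck_on k U (fun x => flat m (u x)).
Proof.
move=> Uo; elim: k m => [|k IH] m Cu.
  split=> // x Ux; apply: (@continuous_comp _ _ _ u (flat m)).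
    exact: Ck_on_cont Cu Ux.
  apply: differentiable_continuous; apply/derivable1_diffP.
  exact: (@ex_derive _ _ _ _ _ _ _ (is_derive_flat m (u x))).
have D i x : U x -> is_derive x (delta_mx 0 i) (fun x => flat m (u x))
    ('D_(delta_mx 0 i) u x * (flat m.+2 (u x) - m%:R * flat m.+1 (u x))).
  move=> Ux; apply: is_derive_comp1; last exact: is_derive_flat.
  by apply: derivableP; exact: Ck_on_derivable Cu Ux.
split=> [x Ux|i].
  apply: (@continuous_comp _ _ _ u (flat m)).
    exact: Ck_on_cont Cu Ux.
  apply: differentiable_continuous; apply/derivable1_diffP.
  exact: (@ex_derive _ _ _ _ _ _ _ (is_derive_flat m (u x))).
split=> [x /(D i)[]//|].
apply: (eq_Ck_on Uo (f := fun x => 'D_(delta_mx 0 i) u x *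
  (flat m.+2 (u x) - m%:R * flat m.+1 (u x)))); first by move=> x /(D i)[].
have Cu' := Ck_onW Cu.
apply: Ck_onM => //; first exact: Ck_on_derive Cu.
apply: Ck_onB => //; first exact: IH.
by apply: Ck_onM => //; [exact: Ck_on_cst|exact: IH].
Qed.

End FlatFunction.

(** * Hadamard's lemma on star-shaped open sets *)

Section Hadamard.
Context {R : realType} {d : nat}.
Local Notation V := 'rV[R]_d.
Local Notation e i := (delta_mx 0 i : V).
Local Notation mu := (@lebesgue_measure R).
Implicit Types (a b : R -> R).

Let I a : R := (\int[mu]_(t in `[0, 1]) a t)%R.
Let cont01 a := {within `[(0 : R), 1], continuous a}.

Let cont01_integrable a : cont01 a -> mu.-integrable `[0, 1] (EFin \o a).
Proof. by move=> ca; apply: continuous_compact_integrable => //; exact: segment_compact. Qed.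

Let cont01D a b : cont01 a -> cont01 b -> cont01 (fun t => a t + b t).
Proof. by move=> ca cb x; apply: cvgD; [exact: ca|exact: cb]. Qed.

Let cont01M a b : cont01 a -> cont01 b -> cont01 (fun t => a t * b t).
Proof. by move=> ca cb x; apply: cvgM; [exact: ca|exact: cb]. Qed.

Let cont01_cst (c : R) : cont01 (fun=> c).
Proof. by move=> x; exact: cvg_cst. Qed.

Let cont01X m : cont01 (fun t => t ^+ m).
Proof. by apply: continuous_subspaceT => t; exact: exprn_continuous. Qed.

Let ID a b : cont01 a -> cont01 b -> I (fun t => a t + b t) = I a + I b.
Proof. by move=> ca cb; apply: RintegralD => //; exact: cont01_integrable. Qed.

Let IZ (c : R) a : cont01 a -> I (fun t => c * a t) = c * I a.
Proof. by move=> ca; apply: RintegralZl => //; exact: cont01_integrable. Qed.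

Let I_sum n (c : 'I_n -> R) (a : 'I_n -> R -> R) : (forall i, cont01 (a i)) ->
  cont01 (fun t => \sum_i c i * a i t) /\
  I (fun t => \sum_i c i * a i t) = \sum_i c i * I (a i).
Proof.
move=> ca; rewrite /index_enum; elim: (X in bigop _ X) => [|i r [IHc IHI]].
  have E : (fun t => \big[+%R/0]_(i <- [::]) (c i * a i t)) = (fun=> 0).
    by apply/funext => t; rewrite big_nil.
  rewrite E big_nil; split; first exact: cont01_cst.
  rewrite (_ : (fun=> 0) = (fun t : R => 0 * (fun=> 0) t)); last first.
    by apply/funext => t; rewrite mul0r.
  by rewrite IZ ?mul0r//; exact: cont01_cst.
have E : (fun t => \big[+%R/0]_(i <- i :: r) (c i * a i t)) =
    (fun t => c i * a i t + \big[+%R/0]_(i <- r) (c i * a i t)).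
  by apply/funext => t; rewrite big_cons.
have cai : cont01 (fun t => c i * a i t) by apply: cont01M => //; exact: cont01_cst.
rewrite E big_cons; split; first exact: cont01D.
by rewrite ID// IHI IZ.
Qed.

Let I_cst (c : R) : I (fun=> c) = c.
Proof.
have m01 : lebesgue_measure (`[0, 1]%classic : set R) = 1%:E.
  by rewrite lebesgue_measure_itv/= lte01 -EFinB subr0.
rewrite /I Rintegral_cst//; transitivity (c * fine 1%:E); last exact: mulr1.
by congr (_ * fine _); exact: m01.
Qed.

Let I_dist a b (eps : R) : cont01 a -> cont01 b ->
  (forall t : R, 0 <= t <= 1 -> `|a t - b t| <= eps) -> `|I a - I b| <= eps.
Proof.
move=> ca cb ab.
have I_le a' b' : cont01 a' -> cont01 b' -> (forall t : R, 0 <= t <= 1 -> a' t <= b' t) ->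
    I a' <= I b'.
  move=> /cont01_integrable ia /cont01_integrable ib ab'.
  by apply: le_Rintegral => // t /=; rewrite in_itv/=; exact: ab'.
have {}ab (t : R) : 0 <= t <= 1 -> (b t + - eps <= a t) && (a t <= b t + eps).
  by move=> /ab; rewrite ler_distl.
have cc (c : R) : cont01 (fun t => b t + c) by apply: cont01D => //; exact: cont01_cst.
have Ic (c : R) : I (fun t => b t + c) = I b + c.
  by rewrite ID ?I_cst//; exact: cont01_cst.
by rewrite ler_distl -!Ic; apply/andP; split; apply: I_le => // t /ab /andP[].
Qed.

Variables (U : set V) (q : V).
Hypothesis Uo : open U.
Hypothesis Ustar : forall x (t : R), U x -> 0 <= t <= 1 -> U (q + t *: (x - q)).

Let seg (t : R) (x : V) : V := q + t *: (x - q).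

Let seg_continuous (z : R * V) : {for z, continuous (fun z => seg z.1 z.2)}.
Proof.
apply: cvgD; first exact: cvg_cst.
apply: cvgZ; first exact: cvg_fst.
apply: cvgB; first exact: cvg_snd.
exact: cvg_cst.
Qed.

Let seg_continuousl x (t : R) : {for t, continuous (seg^~ x)}.
Proof.
apply: cvgD; first exact: cvg_cst.
by apply: cvgZ; [exact: cvg_id|exact: cvg_cst].
Qed.

(** A tube lemma: continuity at every (t, x) becomes uniform in t because [0, 1] is compact. *)
Let seg_uniform (f : V -> R) x (eps : R) :
  (forall y, U y -> {for y, continuous f}) -> U x -> 0 < eps ->
  \forall y \near x, U y /\ 
     forall t : R, 0 <= t <= 1 -> `|f (seg t y) - f (seg t x)| <= eps.
Proof.
move=> cf Ux eps0.
have H : forall t : R, `[(0 : R), 1]%classic t -> \forall t' \near t & y \near x,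
    `|f (seg t' y) - f (seg t' x)| <= eps.
  move=> t; rewrite /= in_itv/= => t01.
  have ft := cf _ (Ustar Ux t01).
  have c1 : f (seg z.1 z.2) @[z --> (t, x)] --> f (seg t x).
    apply: (@continuous_comp _ _ _ (fun z : R * V => seg z.1 z.2) f (t, x)); last exact: ft.
    exact: seg_continuous.
  have c2 : f (seg z.1 x) @[z --> (t, x)] --> f (seg t x).
    apply: (@continuous_comp _ _ _ (fun z : R * V => seg z.1 x) f (t, x)); last exact: ft.
    apply: (@continuous_comp _ _ _ fst (seg^~ x) (t, x)); first exact: cvg_fst.
    exact: seg_continuousl.
  have c3 : f (seg z.1 z.2) - f (seg z.1 x) @[z --> (t, x)] --> (0 : R).
    by rewrite -(subrr (f (seg t x))); exact: cvgB.
  have : \forall z \near (t, x), `|f (seg z.1 z.2) - f (seg z.1 x)| <= eps.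
    by move/cvgr0Pnorm_le : c3; apply.
  exact.
have := (compact_near_coveringP _).1 (@segment_compact R 0 1) V (nbhs x)
  (fun y t => `|f (seg t y) - f (seg t x)| <= eps) (nbhs_filter x) H.
move=> {}H; near=> y; split; first by near: y; exact: open_nbhs_nbhs.
move=> t t01; have : `[0, 1]%classic t by rewrite /= in_itv.
by move: t {t01}; near: y; exact: H.
Unshelve. all: by end_near. Qed.

(** The weight t^m is there because each derivative in x brings out one more factor t. *)
Definition ray_mean m (f : V -> R) x : R :=
  (\int[mu]_(t in `[0, 1]) (t ^+ m * f (q + t *: (x - q))))%R.

Let cont01_seg m (f : V -> R) x :
  (forall y, U y -> {for y, continuous f}) -> U x ->
  cont01 (fun t => t ^+ m * f (seg t x)).
Proof.
move=> cf Ux; apply: cont01M => //.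
apply: continuous_in_subspaceT => t; rewrite inE/= in_itv/= => t01.
apply: (@continuous_comp _ _ _ (seg^~ x) f); last exact: cf (Ustar Ux t01).
exact: seg_continuousl.
Qed.

Let ray_mean_continuous m (f : V -> R) x :
  (forall y, U y -> {for y, continuous f}) -> U x ->
  {for x, continuous (ray_mean m f)}.
Proof.
move=> cf Ux; apply/(@cvgrPdist_le _ _ _ (nbhs x) (nbhs_filter x)) => eps eps0.
have := seg_uniform cf Ux eps0; apply: filterS => y [Uy H].
apply: I_dist; [exact: cont01_seg cf Ux|exact: cont01_seg cf Uy|] => t t01.
have /andP[t0 t1] := t01.
rewrite -mulrBr normrM distrC -[leRHS]mul1r ler_pM// ?H//.
by rewrite normrX exprn_ile1// ger0_norm.
Qed.

(** Differentiation under the integral sign: by the mean value theorem the difference quotient of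
    the integrand is t^(m+1) times the partial derivative of f at a nearby point, and [seg_uniform]
    makes the error uniform in t. *)
Let is_derive_ray_mean m (f : V -> R) x i : Ck_on 1 U f -> U x ->
  is_derive x (e i) (ray_mean m f) (ray_mean m.+1 (fun x => 'D_(e i) f x) x).
Proof.
move=> Cf Ux.
have cf y : U y -> {for y, continuous f} by exact: Ck_on_cont Cf.
have cDf y : U y -> {for y, continuous (fun x => 'D_(e i) f x)}.
  exact: Ck_on_cont (Ck_on_derive i Cf).
have D : h^-1 *: (ray_mean m f (h *: e i + x) - ray_mean m f x) @[h --> 0^'] -->
    ray_mean m.+1 (fun x => 'D_(e i) f x) x.
  apply/cvgrPdist_le => eps eps0.
  have [r /= r0 br] := (nbhs_ballP _ _).1 (seg_uniform cDf Ux eps0).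
  near=> h.
  have h0 : h != 0 by near: h; exact: nbhs_dnbhs_neq.
  have hr : `|h| < r by near: h; exact: dnbhs0_lt.
  have hx (s : R) : 0 <= s <= 1 -> ball x r (s *: (h *: e i) + x).
    move=> /andP[s0 s1]; rewrite -ball_normE /= opprD addrCA subrr addr0 normrN.
    apply: le_lt_trans hr; apply/row_normr_le => // j.
    rewrite !mxE eqxx /= normrM ger0_norm// -[leRHS]mul1r ler_pM//.
    rewrite normrM -[leRHS]mulr1 ler_pM//.
    by case: (j == i); rewrite /= ?normr1 ?normr0.
  have Uh : U (h *: e i + x).
    have h1 : ball x r (h *: e i + x).
      by have := hx 1; rewrite scale1r ler01 lexx; exact.
    by have [] := br _ h1.
  have -> : h^-1 *: (ray_mean m f (h *: e i + x) - ray_mean m f x) =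
      I (fun t => h^-1 * (t ^+ m * f (seg t (h *: e i + x)) +
                          (-1) * (t ^+ m * f (seg t x)))).
    have c1 := cont01_seg (m := m) cf Uh; have c2 := cont01_seg (m := m) cf Ux.
    have c3 : cont01 (fun t => -1 * (t ^+ m * f (seg t x))).
      by apply: cont01M => //; exact: cont01_cst.
    rewrite IZ; last exact: cont01D.
    by rewrite ID// IZ// mulN1r.
  apply: I_dist.
  - exact: (cont01_seg (m := m.+1) cDf Ux).
  - have c1 := cont01_seg (m := m) cf Uh; have c2 := cont01_seg (m := m) cf Ux.
    apply: cont01M; first exact: cont01_cst.
    apply: cont01D; first exact: c1.
    by apply: cont01M; [exact: cont01_cst|exact: c2].
  move=> t t01; have /andP[t0 t1] := t01.
  have E (s : R) : seg t (s *: (h *: e i) + x) = seg t x + s *: ((t * h) *: e i).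
    by rewrite /seg; apply/rowP => j; rewrite !mxE; ring.
  have Us (s : R) : 0 <= s <= 1 -> U (seg t x + s *: ((t * h) *: e i)).
    by move=> s01; rewrite -E; apply: Ustar => //; have [] := br _ (hx s s01).
  have [s s01 Es] := Ck_on_MVT Uo Cf Us.
  have -> : h^-1 * (t ^+ m * f (seg t (h *: e i + x)) + -1 * (t ^+ m * f (seg t x)))
      = t ^+ m.+1 * 'D_(e i) f (seg t (s *: (h *: e i) + x)).
    have -> : seg t (h *: e i + x) = seg t x + (t * h) *: e i.
      by have := E 1; rewrite !scale1r.
    rewrite E mulN1r -mulrBr Es exprSr; field.
    exact: h0.
  rewrite -mulrBr normrM distrC -[leRHS]mul1r ler_pM//.
    by rewrite normrX exprn_ile1// ger0_norm.
  by have [_] := br _ (hx s s01); apply.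
by apply: DeriveDef; [apply/cvg_ex; eexists; exact: D|exact: cvg_lim D].
Unshelve. all: by end_near. Qed.

(* The i-th partial derivative of [ray_mean m f] is [ray_mean m.+1] of that of f. *)
Lemma Ck_on_ray_mean k m (f : V -> R) : Ck_on k U f -> Ck_on k U (ray_mean m f).
Proof.
elim: k m f => [|k IH] m f Cf; split=> //.
- by move=> x Ux; apply: ray_mean_continuous => // y; exact: Ck_on_cont Cf.
- by move=> x Ux; apply: ray_mean_continuous => // y; exact: Ck_on_cont Cf.
have C1 : Ck_on 1 U f by elim: (k) Cf => // k' IHk /Ck_onW.
move=> i; split; first by move=> x /(is_derive_ray_mean m i C1)[].
apply: (eq_Ck_on Uo (f := ray_mean m.+1 (fun x => 'D_(e i) f x))).
  by move=> x /(is_derive_ray_mean m i C1)[].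
by apply: IH; exact: Ck_on_derive.
Qed.

Lemma ray_mean_center (f : V -> R) : ray_mean 0 f q = f q.
Proof.
rewrite /ray_mean subrr; under eq_Rintegral do rewrite expr0 scaler0 addr0 mul1r.
exact: I_cst.
Qed.

(** The fundamental theorem of calculus for f along the ray from q to x. *)
Lemma Hadamard (f : V -> R) x : Ck_on 1 U f -> U x ->
  f x = f q + \sum_i (x - q) 0 i * ray_mean 0 (fun x => 'D_(e i) f x) x.
Proof.
move=> Cf Ux.
pose p (t : R) := f (seg t x).
(* The factor t ^+ 0 makes the integral of each term a [ray_mean 0]. *)
pose p' (t : R) := \sum_i (x - q) 0 i * (t ^+ 0 * 'D_(e i) f (seg t x)).
have pD (t : R) : 0 <= t <= 1 -> is_derive t 1 p (p' t).
  move=> t01; rewrite /p'.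
  under eq_bigr do rewrite expr0 mul1r.
  apply: (is_derive_Ck_on_comp Uo Cf); first exact: Ustar.
  move=> i; set c := (x - q) 0 i.
  rewrite (_ : (fun y => _) = cst (q 0 i) + (c \*: (id : R -> R))).
    by apply: is_derive_eq; rewrite add0r [LHS]mulr1.
  by apply/funext => y; rewrite /c !mxE [RHS]/(_ + _) /= [RHS]/(_ + _) mulrC.
have [cp' Ip'] := I_sum (fun i => (x - q) 0 i)
  (fun i => cont01_seg (m := 0) (fun y => @Ck_on_cont _ _ _ _ _ y (Ck_on_derive i Cf)) Ux).
have pc (t : R) : 0 <= t <= 1 -> {for t, continuous p}.
  move=> t01; apply: differentiable_continuous; apply/derivable1_diffP.
  exact: (@ex_derive _ _ _ _ _ _ _ (pD t t01)).
have : (\int[mu]_(t in `[0%R, 1%R]) (p' t)%:E = (p 1%R)%:E - (p 0%R)%:E)%E.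
  apply: continuous_FTC2 => //.
    split.
    - move=> t; rewrite in_itv/= => /andP[t0 t1].
      have t01 : 0 <= t <= 1 by rewrite !ltW.
      exact: (@ex_derive _ _ _ _ _ _ _ (pD t t01)).
    - by apply: cvg_at_right_filter; apply: pc; rewrite lexx ler01.
    - by apply: cvg_at_left_filter; apply: pc; rewrite lexx ler01.
  move=> t; rewrite in_itv/= => /andP[t0 t1].
  have t01 : 0 <= t <= 1 by rewrite !ltW.
  by rewrite derive1E (@derive_val _ _ _ _ _ _ _ (pD t t01)).
move=> /(congr1 fine) /=; rewrite -[LHS]/(I p') Ip' /p /seg scale0r addr0 scale1r.
rewrite (addrC q) subrK => E; rewrite -[LHS](subrK (f q)) -E addrC.
by [].
Qed.

End Hadamard.

(** * Cut-off coordinates and local frames *)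

Section SmoothFunctionTheory.
Context {R : realType} {d : nat} {M : smoothManifold R d}.
Local Notation C := (smoothFun M).
Local Notation XM := (vectorField M).
Implicit Types (f g : C) (X Y Z : XM) (p q : M).

Lemma smoothFun_eq f g : (forall q, f q = g q) -> f = g.
Proof. by move=> fg; apply: val_inj; apply/funext. Qed.

Lemma smoothD f g q : (f + g) q = f q + g q. Proof. by []. Qed.
Lemma smoothM f g q : (f * g) q = f q * g q. Proof. by []. Qed.
Lemma smoothB f g q : (f - g) q = f q - g q. Proof. by []. Qed.
Lemma smoothX f n q : (f ^+ n) q = f q ^+ n.
Proof. by elim: n => [//|n IH]; rewrite !exprS smoothM IH. Qed.
Lemma smooth_sum (I : Type) (r : seq I) (P : pred I) (F : I -> C) q :
  (\sum_(i <- r | P i) F i) q = \sum_(i <- r | P i) F i q.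
Proof. exact: (big_morph (fun f : C => f q)). Qed.

Lemma vector_eq X Y : (forall f, X f = Y f) -> X = Y.
Proof. by move=> XY; apply: val_inj; apply/funext. Qed.

Lemma vectorDE X Y f : (X + Y) f = X f + Y f. Proof. by []. Qed.
Lemma vectorNE X f : (- X) f = - X f. Proof. by []. Qed.
Lemma vectorZE g X f : (g *: X) f = g * X f. Proof. by []. Qed.
Lemma vector_sumE (I : Type) (r : seq I) (P : pred I) (F : I -> XM) f :
  (\sum_(i <- r | P i) F i) f = \sum_(i <- r | P i) F i f.
Proof. exact: (big_morph (fun X : XM => X f)). Qed.

Lemma vfD X f g : X (f + g) = X f + X g.
Proof. by case: X => X /=; rewrite inE => -[]. Qed.

Lemma vfZ X (a : R) f : X (smooth_cst M a * f) = smooth_cst M a * X f.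
Proof. by case: X => X /=; rewrite inE => -[]. Qed.

Lemma vfM X f g : X (f * g) = f * X g + g * X f.
Proof. by case: X => X /=; rewrite inE => -[]. Qed.

Lemma vf0 X : X 0 = 0.
Proof. by apply: (addrI (X 0)); rewrite -vfD !addr0. Qed.

Lemma vfN X f : X (- f) = - X f.
Proof. by apply: (addrI (X f)); rewrite -vfD !subrr vf0. Qed.

Lemma vfB X f g : X (f - g) = X f - X g.
Proof. by rewrite vfD vfN. Qed.

Lemma vf1 X : X 1 = 0.
Proof. by apply: (addrI (X 1)); rewrite addr0 -[in RHS](mulr1 1) vfM !mul1r. Qed.

Lemma vf_cst X (a : R) : X (smooth_cst M a) = 0.
Proof. by rewrite -[smooth_cst M a]mulr1 vfZ vf1 mulr0. Qed.

Lemma vf_sum X (I : Type) (r : seq I) (P : pred I) (F : I -> C) :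
  X (\sum_(i <- r | P i) F i) = \sum_(i <- r | P i) X (F i).
Proof. by apply: (big_morph X); [exact: vfD|exact: vf0]. Qed.

Lemma chart_from_open (c : chart R d M) (A : set M) :
  open A -> open (chart_cod c `&` chart_from c @^-1` A).
Proof.
move=> Ao; rewrite openE => x [cx Ax]; apply: filterI.
  by apply: open_nbhs_nbhs; split => //; exact: chart_cod_open.
by apply: (chart_from_cont cx); apply: open_nbhs_nbhs.
Qed.

Lemma chart_to_open (c : chart R d M) (B : set 'rV[R]_d) :
  open B -> open (chart_dom c `&` c @^-1` B).
Proof.
move=> Bo; rewrite openE => q [cq Bq]; apply: filterI.
  by apply: open_nbhs_nbhs; split => //; exact: chart_dom_open.
by apply: (chart_to_cont cq); apply: open_nbhs_nbhs.
Qed.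

Lemma smooth_functions_local (h : M -> R) :
  (forall c x, atlas c -> chart_cod c x ->
    exists2 W, W x & smooth_on W (h \o chart_from c)) ->
  h \in smooth_functions (M:=M).
Proof.
move=> loc; rewrite inE /= => c ac k; apply: Ck_on_local => x cx.
by have [W Wx sW] := loc c x ac cx; exists W.
Qed.

Lemma smoothFun_chart f c : atlas c -> smooth_on (chart_cod c) (f \o chart_from c).
Proof. by case: f => f /=; rewrite inE; apply. Qed.

(** For glued objects: their values are known near each point only as quotients of globally defined
    smooth functions. *)
Lemma smooth_functions_quotient (h : M -> R) :
  (forall p, exists2 uv : C * C, uv.2 p != 0 &
    forall q, uv.2 q != 0 -> h q = uv.1 q / uv.2 q) ->
  h \in smooth_functions (M:=M).
Proof.
move=> loc; apply: smooth_functions_local => c x ac cx.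
have [[u v] /= vp huv] := loc (chart_from c x).
pose W := chart_cod c `&` [set y | v (chart_from c y) != 0].
have Wo : open W.
  rewrite openE => y [cy vy]; apply: filterI.
    by apply: open_nbhs_nbhs; split => //; exact: chart_cod_open.
  have cv := Ck_on_cont (smoothFun_chart v ac 0%N) cy.
  exact: cvgr_neq0 cv vy.
exists W => // k.
have Wc : W `<=` chart_cod c by move=> y [].
apply: (eq_Ck_on Wo (f := (u \o chart_from c) * (fun y => (v (chart_from c y))^-1))).
  by move=> y [_ /huv] /= ->.
apply: Ck_onM => //; first exact: Ck_on_sub Wc (smoothFun_chart u ac k).
apply: Ck_on_inv => //; first exact: Ck_on_sub Wc (smoothFun_chart v ac k).
by move=> y [].
Qed.

End SmoothFunctionTheory.

Section Cutoff.
Context {R : realType} {d : nat} {M : smoothManifold R d}.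
Local Notation C := (smoothFun M).
Local Notation XM := (vectorField M).
Local Notation V := 'rV[R]_d.
Local Notation e i := (delta_mx 0 i : V).
Variables (c : chart R d M) (ac : atlas c) (x0 : V) (r : R).
Hypothesis r0 : 0 < r.
(** The bump is supported in the closed cube of radius r; the doubled radius leaves an open
    neighbourhood of that cube inside the chart. *)
Let B : set V := ball x0 (r + r).
Hypothesis Bc : B `<=` chart_cod c.

Definition bump (x : V) : R := \prod_i flat 0 (r ^+ 2 - (x 0 i - x0 0 i) ^+ 2).

Let Bo : open B. Proof. exact: ball_open. Qed.

Lemma Ck_on_bump k U : open U -> Ck_on k U bump.
Proof.
move=> Uo; apply: Ck_on_prod => // i _; apply: Ck_on_flat => //.
have Cx : Ck_on k U ((fun x : V => x 0 i) - cst (x0 0 i)).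
  by apply: Ck_onB => //; [exact: Ck_on_coord|exact: Ck_on_cst].
have := Ck_onB Uo (Ck_on_cst k (r ^+ 2) Uo) (Ck_onM Uo Cx Cx).
by apply: eq_Ck_on => // x _; rewrite expr2.
Qed.

Lemma bump_neq0 x : bump x != 0 -> forall i, `|x 0 i - x0 0 i| < r.
Proof.
move=> + i; rewrite ltNge; apply: contraNN => ri; rewrite /bump (bigD1 i)//=.
rewrite flat_le0 ?mul0r// subr_le0 -[leRHS]real_normK ?num_real//.
by rewrite ler_pXn2r ?nnegrE ?(ltW r0).
Qed.

Lemma bump_center : bump x0 != 0.
Proof.
apply/prodf_neq0 => i _; rewrite gt_eqF// flat_gt0// subrr expr0n subr0.
by rewrite exprn_gt0.
Qed.

Lemma bump_ball x : bump x != 0 -> B x.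
Proof.
move=> /bump_neq0 xr; rewrite /B -ball_normE /=; apply: (@le_lt_trans _ _ r).
  apply/row_normr_le => [|i]; first exact: ltW.
  by rewrite !mxE distrC ltW.
by rewrite ltrDl.
Qed.

Definition cutoff (h : V -> R) (q : M) : R :=
  if `[< chart_dom c q >] then bump (c q) * h (c q) else 0.

Lemma cutoffE h q : chart_dom c q -> cutoff h q = bump (c q) * h (c q).
Proof. by move=> cq; rewrite /cutoff asboolT. Qed.

Lemma cutoff_out h q : ~ chart_dom c q -> cutoff h q = 0.
Proof. by move=> cq; rewrite /cutoff asboolF. Qed.

Let box : set V := [set x : V | forall i, `[x0 0 i - r, x0 0 i + r]%classic (x 0 i)].

(** Here the Hausdorff property enters: the image of the compact cube is closed in M, so cut-off
    functions vanish on an open complement. *)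
Let box_closed : closed (chart_from c @` box).
Proof.
apply: compact_closed; first exact: manifold_hausdorff.
apply: continuous_compact; last first.
  by apply: (@rV_compact _ _ (fun i => `[x0 0 i - r, x0 0 i + r]%classic)) => i;
    exact: segment_compact.
apply: continuous_in_subspaceT => x; rewrite inE => bx.
apply: chart_from_cont; apply: Bc; rewrite /B -ball_normE /=.
apply: (@le_lt_trans _ _ r); last by rewrite ltrDl.
apply/row_normr_le => [|i]; [exact: ltW|rewrite !mxE distrC ler_distl].
by have := bx i; rewrite /= in_itv.
Qed.

(** Two open sets cover M: the part of the chart over B, where the function is a smooth one composed
    with a transition map, and the complement of the image of the cube, where it is zero. *)
Lemma cutoff_smooth h : smooth_on B h -> cutoff h \in smooth_functions (M:=M).
Proof.
move=> sh; apply: smooth_functions_local => c' x ac' cx.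
have [[cp Bp]|np] := pselect ((chart_dom c `&` c @^-1` B) (chart_from c' x)).
  pose W := chart_cod c' `&` chart_from c' @^-1` (chart_dom c `&` c @^-1` B).
  have Wo : open W by apply: chart_from_open; exact: chart_to_open.
  exists W => // k.
  apply: (eq_Ck_on Wo (f := (bump * h) \o (c \o chart_from c'))).
    by move=> y [_ [cy _]]; rewrite /= cutoffE.
  apply: (Ck_on_comp Bo Wo) => [y [_ []]//||i].
    by apply: Ck_onM => //; exact: Ck_on_bump.
  apply: Ck_on_sub (atlas_compat ac' ac i k) => y [cy [cy' _]]; by split.
pose W := chart_cod c' `&` chart_from c' @^-1` (~` (chart_from c @` box)).
have Wo : open W by apply: chart_from_open; rewrite openC.
exists W.
  split=> // -[y by_ yx]; apply: np; rewrite -yx.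
  have By : B y.
    rewrite /B -ball_normE /=; apply: (@le_lt_trans _ _ r); last by rewrite ltrDl.
    apply/row_normr_le => [|i]; [exact: ltW|rewrite !mxE distrC ler_distl].
    by have := by_ i; rewrite /= in_itv.
  have cy := Bc By.
  by split; [exact: chart_from_dom|rewrite /= chart_fromK].
move=> k; apply: (eq_Ck_on Wo _ (Ck_on_cst k 0 Wo)) => y [_ ny] /=.
have [cy|cy] := pselect (chart_dom c (chart_from c' y)); last by rewrite cutoff_out.
rewrite cutoffE//; have [->|/bump_neq0 by_] := eqVneq (bump (c (chart_from c' y))) 0.
  by rewrite mul0r.
exfalso; apply: ny; exists (c (chart_from c' y)); last exact: chart_toK.
by move=> i; rewrite /= in_itv/= -ler_distl ltW.
Qed.

Definition cut h (sh : smooth_on B h) : C := SmoothFun (cutoff_smooth sh).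

Let smooth_cst1 : smooth_on B (cst 1).
Proof. by move=> k; exact: Ck_on_cst. Qed.

Let smooth_coord i : smooth_on B (fun x : V => x 0 i).
Proof. by move=> k; exact: Ck_on_coord. Qed.

Let smooth_partial i (f : C) : smooth_on B (fun x => 'D_(e i) (f \o chart_from c) x).
Proof.
move=> k; apply: Ck_on_derive; apply: Ck_on_sub Bc _; exact: smoothFun_chart.
Qed.

(** Coordinates x_i and fields d/dx_i are not global. Their substitutes are rho = bump, y_i = rho
    x_i and the derivations rho d/dx_i, all extended by zero. *)
Definition cut_one : C := cut smooth_cst1.
Definition cut_coord i : C := cut (smooth_coord i).
Definition cut_partial i (f : C) : C := cut (smooth_partial i f).

Let partial_derivable i (f : C) q : chart_dom c q ->
  derivable (f \o chart_from c) (c q) (e i).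
Proof.
move=> cq.
exact: (Ck_on_derivable i (smoothFun_chart f ac 1%N) (chart_to_cod cq)).
Qed.

Lemma cut_partial_derivation i :
  (cut_partial i : smoothFun M -> (smoothFun M)^o) \in derivations (M:=M).
Proof.
rewrite inE /=; split=> [f g|a f|f g]; apply: smoothFun_eq => q;
  rewrite ?(smoothD, smoothM) /=;
  (have [cq|cq] := pselect (chart_dom c q);
    last by rewrite !cutoff_out// ?(mulr0, addr0)); rewrite !cutoffE//.
- have -> : ((f + g) \o chart_from c) = (f \o chart_from c) + (g \o chart_from c).
    by [].
  by rewrite deriveD ?mulrDr//; exact: partial_derivable.
- have -> : ((smooth_cst M a * f) \o chart_from c) = a \*: (f \o chart_from c).
    by [].
  by rewrite deriveZ; [rewrite mulrCA|exact: partial_derivable].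
- have -> : ((f * g) \o chart_from c) = (f \o chart_from c) * (g \o chart_from c).
    by [].
  rewrite deriveM; [|exact: partial_derivable..].
  by rewrite /= chart_toK// mulrDr; congr (_ + _); rewrite mulrCA.
Qed.

Definition cut_field i : XM := VectorField (cut_partial_derivation i).

(** The quotient rule for x_j = y_j / rho, cleared of denominators: the left side is rho^2 E_i(x_j)
    with E_i = rho d/dx_i. *)
Lemma cut_field_coord i j :
  cut_one * cut_field i (cut_coord j) - cut_coord j * cut_field i cut_one =
  (i == j)%:R * cut_one ^+ 3.
Proof.
apply: smoothFun_eq => q; rewrite smoothB 3!smoothM smoothX /=.
have -> : ((i == j)%:R : C) q = (i == j)%:R by case: eqP.
have [cq|cq] := pselect (chart_dom c q); last first.
  by rewrite !cutoff_out// expr0n !mul0r subr0 mulr0.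
have bE : (cut_one : C) \o chart_from c = fun x => cut_one (chart_from c x) by [].
rewrite !cutoffE//=.
have near_cod : \forall x \near c q, chart_cod c x.
  apply: open_nbhs_nbhs; split; [exact: chart_cod_open|exact: chart_to_cod].
have E1 : \forall x \near c q, ((cut_coord j : C) \o chart_from c) x =
    (bump * (fun x : V => x 0 j)) x.
  apply: filterS near_cod => x cx /=.
  by rewrite cutoffE ?chart_fromK//; exact: chart_from_dom.
have E2 : \forall x \near c q, ((cut_one : C) \o chart_from c) x = bump x.
  apply: filterS near_cod => x cx /=.
  by rewrite cutoffE ?chart_fromK ?mulr1//; exact: chart_from_dom.
rewrite (near_eq_derive _ E1) (near_eq_derive _ E2).
have Cb : Ck_on 1 setT bump by apply: Ck_on_bump; exact: openT.
have db : derivable bump (c q) (e i) by exact: Ck_on_derivable Cb I.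
have [dx dxE] := is_derive_coord (c q) (e i) j.
rewrite deriveM// dxE mxE eqxx /= /GRing.scale /= (eq_sym j).
ring.
Qed.

(* With u the coordinates of q, apply Z to the Hadamard decomposition
   rho^2 (f - f(q)) = sum_i (y_i - u_i rho) (rho G_i), where G_i is the ray mean
   of the i-th partial derivative of f, and evaluate at q. *)
Lemma cut_field_span (Z : XM) :
  cut_one ^+ 3 *: Z =
  \sum_i (cut_one * Z (cut_coord i) - cut_coord i * Z cut_one) *: cut_field i.
Proof.
apply: vector_eq => f; apply: smoothFun_eq => q.
rewrite vectorZE vector_sumE smooth_sum smoothM smoothX.
have [b0|b0] := eqVneq (cut_one q) 0.
  rewrite b0 expr0n mul0r big1// => i _; rewrite vectorZE smoothM [X in _ * X]/=.
  have [cq|cq] := pselect (chart_dom c q); last by rewrite cutoff_out// mulr0.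
  move: b0; rewrite /= !cutoffE//= mulr1 => ->; by rewrite mul0r mulr0.
have cq : chart_dom c q by apply: contrapT => cq; rewrite /= cutoff_out ?eqxx in b0.
have bq : bump (c q) != 0 by move: b0; rewrite /= cutoffE// mulr1.
set u := c q.
have Bu : B u by exact: bump_ball.
pose F := f \o chart_from c.
have CF k : Ck_on k B F by apply: Ck_on_sub Bc _; exact: smoothFun_chart.
(* A ball is convex, hence star-shaped about the point u, which need not be its centre. *)
have Bstar x (t : R) : B x -> 0 <= t <= 1 -> B (u + t *: (x - u)).
  move: Bu; rewrite /B -!ball_normE /= => Bu Bx /andP[t0 t1].
  have -> : x0 - (u + t *: (x - u)) = (1 - t) *: (x0 - u) + t *: (x0 - x).
    by apply/rowP => i; rewrite !mxE; ring.
  apply: (le_lt_trans (ler_normD _ _)); rewrite !normrZ !ger0_norm ?subr_ge0//.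
  have -> : r + r = (1 - t) * (r + r) + t * (r + r) by ring.
  have [->|t0'] := eqVneq t 0; first by rewrite subr0 !mul1r !mul0r ltrD2r.
  by apply: ler_ltD; [rewrite ler_wpM2l ?subr_ge0// ltW|rewrite ltr_pM2l ?lt0r ?t0'].
pose G i := ray_mean u 0 (fun x => 'D_(e i) F x).
have sG i : smooth_on B (G i).
  move=> k; apply: (Ck_on_ray_mean Bo Bstar); exact: Ck_on_derive (CF k.+1).
have E : cut_one ^+ 2 * (f - smooth_cst M (f q)) =
    \sum_i (cut_coord i - smooth_cst M (u 0 i) * cut_one) * cut (sG i).
  apply: smoothFun_eq => q'; rewrite smoothM smooth_sum smoothX.
  have [b0'|b0'] := eqVneq (cut_one q') 0.
    rewrite b0' expr0n mul0r big1// => i _; rewrite smoothM [X in _ * X]/=.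
    have [cq'|cq'] := pselect (chart_dom c q'); last by rewrite cutoff_out// mulr0.
    move: b0'; rewrite /= !cutoffE//= mulr1 => ->; by rewrite mul0r mulr0.
  have cq' : chart_dom c q'.
    by apply: contrapT => cq'; rewrite /= cutoff_out ?eqxx in b0'.
  have bq' : bump (c q') != 0 by move: b0'; rewrite /= cutoffE// mulr1.
  have Ef := Hadamard Bo Bstar (CF 1%N) (bump_ball bq').
  rewrite /F /= /u !chart_toK// in Ef.
  rewrite smoothB Ef [smooth_cst M _ _]/= [cut_one q']/= cutoffE// [cst 1 _]/=.
  rewrite mulr1 [X in _ * X]addrAC subrr add0r mulr_sumr.
  apply: eq_bigr => i _; rewrite !(smoothM, smoothB) /= !cutoffE//= !mxE.
  rewrite /G /F /u; ring.
have := congr1 (fun h : C => Z h q) E.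
rewrite vfM vfB vf_cst subr0 vf_sum smooth_sum.
(* The factor y_i - u_i rho vanishes at q, so only the term where Z differentiates it survives, and
   a ray mean at its base point is the value of the function. *)
have Zt i : Z ((cut_coord i - smooth_cst M (u 0 i) * cut_one) * cut (sG i)) q =
    (Z (cut_coord i) q - u 0 i * Z cut_one q) * cut_partial i f q.
  rewrite vfM vfB vfZ smoothD !smoothM !smoothB !smoothM /= !cutoffE//=.
  rewrite /G ray_mean_center /F -/u; ring.
under eq_bigr do rewrite Zt.
rewrite smoothD 2!smoothM smoothB smoothX.
have -> : smooth_cst M (f q) q = f q by [].
rewrite subrr mul0r addr0 => {}E.
rewrite exprS -mulrA E mulr_sumr; apply: eq_bigr => i _.
rewrite vectorZE smoothM smoothB !smoothM mulrA; congr (_ * _).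
rewrite [cut_coord i q]/= [cut_one q]/= !cutoffE//= -/u; ring.
Qed.

End Cutoff.

(** All the data are global, so the algebra that follows runs over C^oo(M); only the condition on
    [rho] at p is local. *)
Lemma local_frame (R : realType) (d : nat) (M : smoothManifold R d) (p : M) :
  exists (rho : smoothFun M) (y : 'I_d -> smoothFun M) (E : 'I_d -> vectorField M),
  [/\ rho p != 0,
    forall i j, rho * E i (y j) - y j * E i rho = (i == j)%:R * rho ^+ 3 &
    forall Z : vectorField M,
      rho ^+ 3 *: Z = \sum_i (rho * Z (y i) - y i * Z rho) *: E i].
Proof.
have [c ac cp] := atlas_cover p.
have /nbhs_ballP[r /= r0 br] : nbhs (c p) (chart_cod c).
  by apply: open_nbhs_nbhs; split; [exact: chart_cod_open|exact: chart_to_cod].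
have r20 : 0 < r / 2 by rewrite divr_gt0.
have Bc : ball (c p) (r / 2 + r / 2) `<=` chart_cod c by rewrite -splitr.
exists (cut_one ac r20 Bc), (cut_coord ac r20 Bc), (cut_field ac r20 Bc); split.
- by rewrite /= cutoffE// mulr1 bump_center.
- exact: cut_field_coord.
- exact: cut_field_span.
Qed.

(** * The musical isomorphism *)

Section Musical.
Context {R : realType} {d : nat} {M : smoothManifold R d}.
Local Notation C := (smoothFun M).
Local Notation XM := (vectorField M).
Implicit Types (f h : C) (X Y Z : XM) (p q : M).

(** Named in order to carry a ring morphism structure, through which determinants are evaluated at a
    point. *)
Definition eval_at p f : R := f p.

Fact eval_at_zmod_morphism p : zmod_morphism (eval_at p).
Proof. by []. Qed.
HB.instance Definition _ p :=
  GRing.isZmodMorphism.Build C R (eval_at p) (eval_at_zmod_morphism p).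

Fact eval_at_monoid_morphism p : monoid_morphism (eval_at p).
Proof. by []. Qed.
HB.instance Definition _ p :=
  GRing.isMonoidMorphism.Build C R (eval_at p) (eval_at_monoid_morphism p).

Variable g : XM -> XM -> C.
Hypothesis gm : riemannian_metric g.

Lemma metricC X Y : g X Y = g Y X. Proof. exact: (Defs.metric_sym gm). Qed.

Lemma metricDl X Y Z : g (X + Y) Z = g X Z + g Y Z.
Proof. by have := metric_lin gm 1 X Y Z; rewrite scale1r mul1r. Qed.

Lemma metric0l Z : g 0 Z = 0.
Proof. by apply: (addrI (g 0 Z)); rewrite -metricDl !addr0. Qed.

Lemma metricZl f X Z : g (f *: X) Z = f * g X Z.
Proof. by have := metric_lin gm f X 0 Z; rewrite metric0l !addr0. Qed.

Lemma metricNl X Z : g (- X) Z = - g X Z.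
Proof. by rewrite -scaleN1r metricZl mulN1r. Qed.

Lemma metricBl X Y Z : g (X - Y) Z = g X Z - g Y Z.
Proof. by rewrite metricDl metricNl. Qed.

Lemma metricDr X Y Z : g Z (X + Y) = g Z X + g Z Y.
Proof. by rewrite !(metricC Z) metricDl. Qed.

Lemma metric0r Z : g Z 0 = 0.
Proof. by rewrite metricC metric0l. Qed.

Lemma metricZr f X Z : g Z (f *: X) = f * g Z X.
Proof. by rewrite !(metricC Z) metricZl. Qed.

Lemma metricNr X Z : g Z (- X) = - g Z X.
Proof. by rewrite !(metricC Z) metricNl. Qed.

Lemma metric_suml (I : Type) (r : seq I) (P : pred I) (F : I -> XM) Z :
  g (\sum_(i <- r | P i) F i) Z = \sum_(i <- r | P i) g (F i) Z.
Proof. by apply: (big_morph (g^~ Z)) => [X Y|]; rewrite ?metricDl ?metric0l. Qed.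

Lemma metric_sumr (I : Type) (r : seq I) (P : pred I) (F : I -> XM) Z :
  g Z (\sum_(i <- r | P i) F i) = \sum_(i <- r | P i) g Z (F i).
Proof. by rewrite metricC metric_suml; apply: eq_bigr => i _; rewrite metricC. Qed.

Lemma metric_vanish X p : g X X p = 0 -> forall f, X f p = 0.
Proof.
move=> gX f; apply/eqP; apply: contraT => Xf.
by have := metric_pos gm (ex_intro _ f Xf); rewrite gX ltxx.
Qed.

Lemma metric_inj X Y : (forall Z, g X Z = g Y Z) -> X = Y.
Proof.
move=> XY; apply: vector_eq => f; apply: smoothFun_eq => q.
apply/eqP; rewrite -subr_eq0 -smoothB.
have -> : X f - Y f = (X - Y) f by [].
by apply/eqP; apply: metric_vanish; rewrite metricBl XY subrr.
Qed.

Section Representation.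
Variable alpha : XM -> C.
Hypothesis alpha_lin : forall f X Y, alpha (f *: X + Y) = f * alpha X + alpha Y.

Let alphaD X Y : alpha (X + Y) = alpha X + alpha Y.
Proof. by have := alpha_lin 1 X Y; rewrite scale1r mul1r. Qed.

Let alpha0 : alpha 0 = 0.
Proof. by apply: (addrI (alpha 0)); rewrite -alphaD !addr0. Qed.

Let alphaZ f X : alpha (f *: X) = f * alpha X.
Proof. by have := alpha_lin f X 0; rewrite alpha0 !addr0. Qed.

Let alpha_sum (I : Type) (r : seq I) (P : pred I) (F : I -> XM) :
  alpha (\sum_(i <- r | P i) F i) = \sum_(i <- r | P i) alpha (F i).
Proof. exact: (big_morph alpha). Qed.

(* Cramer's rule for the Gram matrix of a local frame. *)
Lemma locally_representable p :
  exists2 W : XM * C, W.2 p != 0 & forall Z, g W.1 Z = W.2 * alpha Z.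
Proof.
have [rho [y [E [rp dual span]]]] := local_frame p.
pose G : 'M[C]_d := \matrix_(i, j) g (E i) (E j).
have detG : (\det G) p != 0.
  have -> : (\det G) p = \det (map_mx (eval_at p) G) by rewrite det_map_mx.
  (* A kernel vector v of the Gram matrix at p yields a field V with g(V, V) = 0 at p. Then V
     vanishes at p, while pairing it with y_j through [dual] gives v_j rho(p)^3. *)
  apply/negP => /eqP /eqP /det0P[v v0 vG].
  pose V := \sum_i smooth_cst M (v 0 i) *: E i.
  have gVE k : g V (E k) p = 0.
    rewrite metric_suml smooth_sum; move/rowP : vG => /(_ k).
    rewrite !mxE => vGk; rewrite -[RHS]vGk; apply: eq_bigr => i _.
    by rewrite metricZl !mxE.
  have gVV : g V V p = 0.
    rewrite {2}/V metric_sumr smooth_sum big1// => i _.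
    by rewrite metricZr smoothM gVE mulr0.
  have Vp := metric_vanish gVV.
  case/negP: v0; apply/eqP/rowP => j; rewrite mxE; apply/eqP.
  have : (rho * V (y j) - y j * V rho) p = 0.
    by rewrite smoothB !smoothM !Vp !mulr0 subrr.
  have -> : rho * V (y j) - y j * V rho = smooth_cst M (v 0 j) * rho ^+ 3.
    rewrite !vector_sumE !mulr_sumr -sumrB (bigD1 j)// big1 => [|i ij].
      rewrite !vectorZE (mulrCA rho) (mulrCA (y j)) -mulrBr dual eqxx.
      by rewrite mulr1n mul1r; exact: addr0.
    rewrite !vectorZE (mulrCA rho) (mulrCA (y j)) -mulrBr dual (negbTE ij).
    by rewrite mulr0n mul0r mulr0.
  rewrite smoothM smoothX => /eqP; rewrite mulf_eq0 expf_eq0 /=.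
  by rewrite (negbTE rp) orbF.
pose W0 := \sum_i (\sum_j alpha (E j) * (\adj G) j i) *: E i.
have W0E k : g W0 (E k) = alpha (E k) * \det G.
  rewrite metric_suml.
  under eq_bigr do rewrite metricZl mulr_suml.
  rewrite exchange_big /=.
  have adjG j : \sum_i (\adj G) j i * g (E i) (E k) = (\det G) *+ (j == k).
    have /matrixP /(_ j k) := mul_adj_mx G; rewrite !mxE => <-.
    by apply: eq_bigr => i _; rewrite [G i k]mxE.
  under eq_bigr => j _.
    under eq_bigr do rewrite -mulrA.
    rewrite -mulr_sumr adjG.
    over.
  rewrite (bigD1 k)//= eqxx mulr1n big1 ?addr0// => j /negbTE ->.
  by rewrite mulr0n mulr0.
(* W0 is right against the frame only; the factor rho^3 moves an arbitrary Z into its span. *)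
exists (rho ^+ 3 *: W0, rho ^+ 3 * \det G) => [|Z]; rewrite [(_, _).2]/=.
  by rewrite smoothM smoothX mulf_neq0// expf_neq0.
have -> : g (rho ^+ 3 *: W0) Z = g W0 (rho ^+ 3 *: Z).
  by rewrite metricZl metricZr.
rewrite mulrAC -alphaZ span metric_sumr alpha_sum mulr_suml.
by apply: eq_bigr => i _; rewrite metricZr alphaZ W0E mulrA.
Qed.

(** The span formula writes rho^3 X through the values of X on functions, so g(X, Z) at p depends
    only on X at p. *)
Let vanish_metric X p Z : (forall f, X f p = 0) -> g X Z p = 0.
Proof.
move=> X0; have [rho [y [E [rp _ span]]]] := local_frame p.
have : (rho ^+ 3 * g X Z) p = 0.
  rewrite -metricZl span metric_suml smooth_sum big1// => i _.
  by rewrite metricZl smoothM smoothB !smoothM !X0 !mulr0 subrr mul0r.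
by rewrite smoothM smoothX => /eqP; rewrite mulf_eq0 expf_eq0 /= (negbTE rp) => /eqP.
Qed.

Theorem representable : exists W, forall Z, g W Z = alpha Z.
Proof.
have loc p : exists W : XM * C, W.2 p != 0 /\ forall Z, g W.1 Z = W.2 * alpha Z.
  by have [W] := locally_representable p; exists W.
have [F HF] := choice loc.
have Fp p : (F p).2 p != 0 by have [] := HF p.
have Fg p Z : g (F p).1 Z = (F p).2 * alpha Z by have [_] := HF p.
(* V pairs with every Z to (delta_p delta_q - delta_q delta_p) alpha(Z) = 0, in particular with
   itself. *)
have agree p q f : (F p).2 q * (F q).1 f q = (F q).2 q * (F p).1 f q.
  pose V := (F p).2 *: (F q).1 - (F q).2 *: (F p).1.
  have gV : g V V = 0.
    by rewrite {1}/V metricBl !metricZl !Fg mulrCA subrr.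
  have := @metric_vanish V q (congr1 (fun h : C => h q) gV) f.
  by rewrite smoothB !smoothM => /eqP; rewrite subr_eq0 => /eqP.
(* The value at q uses the representative chosen for q; by [wE] any representative whose delta does
   not vanish at q gives the same value, hence smoothness. *)
pose w (f : C) (q : M) : R := (F q).1 f q / (F q).2 q.
have wE p q f : (F p).2 q != 0 -> w f q = (F p).1 f q / (F p).2 q.
  move=> pq; rewrite /w; apply/eqP.
  by rewrite eqr_div// mulrC agree mulrC.
have ws f : w f \in smooth_functions (M:=M).
  apply: smooth_functions_quotient => p; exists ((F p).1 f, (F p).2) => //= q.
  exact: wE.
pose D (f : C) : C^o := SmoothFun (ws f).
have DD : D \in derivations (M:=M).
  rewrite inE /=; split=> [f h|a f|f h]; apply: smoothFun_eq => q;
    rewrite ?(smoothD, smoothM) /= /w ?(vfD, vfZ, vfM) ?(smoothD, smoothM).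
  - by rewrite mulrDl.
  - by rewrite mulrA.
  - by rewrite mulrDl !mulrA.
exists (VectorField DD) => Z; apply: smoothFun_eq => q.
set W := VectorField DD.
pose V := (F q).2 *: W - (F q).1.
have V0 f : V f q = 0.
  have -> : V f q = (F q).2 q * w f q - (F q).1 f q by [].
  by rewrite /w mulrC divfK ?subrr.
have := vanish_metric Z V0; rewrite metricBl metricZl Fg smoothB !smoothM.
by move=> /eqP; rewrite subr_eq0 => /eqP /(mulfI (Fp q)).
Qed.

End Representation.
End Musical.

(** * Metric connections with prescribed torsion *)

Section Brackets.
Context {R : realType} {d : nat} {M : smoothManifold R d}.
Local Notation C := (smoothFun M).
Local Notation XM := (vectorField M).
Local Notation "[v X , Y ]" := (lie_bracket X Y) (at level 0).
Implicit Types (f h : C) (X Y Z : XM).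

(** C^oo(M) is only a ring, so 1/2 is kept as an element characterised by [half_double]. *)
Definition half : C := smooth_cst M 2^-1.

Lemma half_double : half + half = 1 :> C.
Proof. by apply: smoothFun_eq => q; rewrite [RHS](splitr 1) div1r. Qed.

Lemma bracketE X Y f : [v X, Y] f = X (Y f) - Y (X f). Proof. by []. Qed.

Lemma bracketC X Y : [v Y, X] = - [v X, Y].
Proof. by apply: vector_eq => f; rewrite vectorNE !bracketE opprB. Qed.

Lemma bracketDl X Y Z : [v X + Y, Z] = [v X, Z] + [v Y, Z].
Proof. by apply: vector_eq => f; rewrite !(bracketE, vectorDE) vfD; ring. Qed.

Lemma bracketZl f X Y : [v f *: X, Y] = f *: [v X, Y] - (Y f : C) *: X.
Proof.
apply: vector_eq => h; rewrite !(vectorDE, vectorNE, vectorZE, bracketE) vfM; ring.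
Qed.

Lemma bracketDr X Y Z : [v Z, X + Y] = [v Z, X] + [v Z, Y].
Proof. by rewrite bracketC bracketDl opprD -!bracketC. Qed.

Lemma bracketZr f X Y : [v X, f *: Y] = f *: [v X, Y] + (X f : C) *: Y.
Proof. by rewrite bracketC bracketZl opprD opprK -scalerN -bracketC. Qed.

End Brackets.

Section Forms.
Context {R : realType} {d : nat} {M : smoothManifold R d}.
Local Notation C := (smoothFun M).
Local Notation XM := (vectorField M).
Implicit Types (f h : C) (X Y Z : XM).

Section Linear.
Variables (W : lmodType C) (u : XM -> W).
Hypothesis ul : forall f X Y, u (f *: X + Y) = f *: u X + u Y.

Lemma tensorD X Y : u (X + Y) = u X + u Y.
Proof. by have := ul 1 X Y; rewrite !scale1r. Qed.

Lemma tensor0 : u 0 = 0.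
Proof. by apply: (addrI (u 0)); rewrite -tensorD !addr0. Qed.

Lemma tensorZ f X : u (f *: X) = f *: u X.
Proof. by have := ul f X 0; rewrite tensor0 !addr0. Qed.

Lemma tensorN X : u (- X) = - u X.
Proof. by rewrite -[- X]scaleN1r tensorZ scaleN1r. Qed.

Lemma tensor_sum (I : Type) (r : seq I) (P : pred I) (F : I -> XM) :
  u (\sum_(i <- r | P i) F i) = \sum_(i <- r | P i) u (F i).
Proof. by apply: (big_morph u); [exact: tensorD|exact: tensor0]. Qed.

End Linear.

End Forms.

Section Connections.
Context {R : realType} {d : nat} {M : smoothManifold R d}.
Local Notation C := (smoothFun M).
Local Notation XM := (vectorField M).
Local Notation "[v X , Y ]" := (lie_bracket X Y) (at level 0).
Local Notation half := (@half R d M).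
Implicit Types (f h : C) (X Y Z : XM).

Variable g : XM -> XM -> C.
Hypothesis gm : riemannian_metric g.

Let gE := (metricDl gm, metricDr gm, metricZl gm, metricZr gm, metricNl gm,
           metricNr gm).

Definition koszul X Y Z : C :=
  X (g Y Z) + Y (g X Z) - Z (g X Y)
  + g [v X, Y] Z - g [v X, Z] Y - g [v Y, Z] X.

Let vE := (@vectorDE _ _ M, @vectorNE _ _ M, @vectorZE _ _ M, @vfD _ _ M,
           @vfN _ _ M, @vfM _ _ M).
Let bE := (@bracketDl _ _ M, @bracketDr _ _ M, @bracketZl _ _ M, @bracketZr _ _ M).

Lemma koszul_lin1 f X X' Y Z :
  koszul (f *: X + X') Y Z = f * koszul X Y Z + koszul X' Y Z.
Proof. by rewrite /koszul !(bE, gE, vE); ring. Qed.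

Lemma koszul_add2 X Y Y' Z : koszul X (Y + Y') Z = koszul X Y Z + koszul X Y' Z.
Proof. by rewrite /koszul !(bE, gE, vE); ring. Qed.

Lemma koszul_leibniz X f Y Z :
  koszul X (f *: Y) Z = (X f : C) * g Y Z + (X f : C) * g Y Z + f * koszul X Y Z.
Proof. by rewrite /koszul !(bE, gE, vE) (metricC gm Y X); ring. Qed.

Lemma koszul_lin3 f X Y Z Z' :
  koszul X Y (f *: Z + Z') = f * koszul X Y Z + koszul X Y Z'.
Proof.
by rewrite /koszul !(bE, gE, vE) (metricC gm Z X) (metricC gm Z Y); ring.
Qed.

Lemma koszul_metric X Y Z : koszul X Y Z + koszul X Z Y = X (g Y Z) + X (g Y Z).
Proof.
rewrite /koszul (bracketC Y Z) (metricC gm Z Y) !gE.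
ring.
Qed.

Lemma koszul_torsion X Y Z : koszul X Y Z - koszul Y X Z = g [v X, Y] Z + g [v X, Y] Z.
Proof.
rewrite /koszul (bracketC X Y) (metricC gm X Y) !gE.
ring.
Qed.

Definition metric_connection (nabla : XM -> XM -> XM) : Prop :=
  affine_connection nabla /\
  forall X Y Z, X (g Y Z) = g (nabla X Y) Z + g Y (nabla X Z) :> C.

(** Koszul's formula with T added to it. Skewness of T in the last two arguments keeps the
    connection metric, and skewness in the first two makes T its torsion. *)
Lemma connection_of_torsion (T : XM -> XM -> XM -> C) : three_form T ->
  exists nabla, [/\ metric_connection nabla,
    forall X Y Z, g (torsion nabla X Y) Z = T X Y Z &
    forall X Y Z, g (nabla X Y) Z = half * (koszul X Y Z + T X Y Z)].
Proof.
case=> T1 T2 T3 T12 T23.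
have ex (XY : XM * XM) : exists W, forall Z,
    g W Z = half * (koszul XY.1 XY.2 Z + T XY.1 XY.2 Z).
  apply: representable => // f Z Z'.
  by rewrite koszul_lin3 T3//; ring.
have [F FE] := choice ex; pose nabla X Y := F (X, Y).
have nE X Y Z : g (nabla X Y) Z = half * (koszul X Y Z + T X Y Z).
  exact: (FE (X, Y)).
have T2D X Y Y' Z : T X (Y + Y') Z = T X Y Z + T X Y' Z.
  by have := T2 1 X Y Y' Z I I I I; rewrite scale1r mul1r.
have T20 X Z : T X 0 Z = 0 by apply: (addrI (T X 0 Z)); rewrite -T2D !addr0.
have T2Z f X Y Z : T X (f *: Y) Z = f * T X Y Z.
  by have := T2 f X Y 0 Z I I I I; rewrite T20 !addr0.
exists nabla; split=> //; first split; first split.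
- by move=> f X X' Y; apply: (metric_inj gm) => Z; rewrite !gE !nE koszul_lin1 T1//; ring.
- move=> X Y Y'; apply: (metric_inj gm) => Z; rewrite !gE !nE koszul_add2 T2D; ring.
- move=> X f Y; apply: (metric_inj gm) => Z; rewrite !gE !nE koszul_leibniz T2Z.
  by rewrite -[X in _ = X + _]mul1r -half_double; ring.
- move=> X Y Z; rewrite (metricC gm Y (nabla X Z)) !nE (T23 X Y Z)// -mulrDr.
  have -> : koszul X Y Z + T X Y Z + (koszul X Z Y - T X Y Z) =
      koszul X Y Z + koszul X Z Y by ring.
  by rewrite koszul_metric mulrDr -mulrDl half_double mul1r.
- move=> X Y Z; rewrite /torsion !gE !nE (T12 X Y Z)//.
  have -> : half * (koszul X Y Z + T X Y Z) - half * (koszul Y X Z - T X Y Z) =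
      half * (koszul X Y Z - koszul Y X Z) + (half + half) * T X Y Z by ring.
  by rewrite koszul_torsion half_double mulrDr -mulrDl half_double; ring.
Qed.

End Connections.

(** * Almost contact metric structures *)

Section AlmostContact.
Context {R : realType} {d : nat} {M : smoothManifold R d}.
Local Notation C := (smoothFun M).
Local Notation XM := (vectorField M).
Local Notation "[v X , Y ]" := (lie_bracket X Y) (at level 0).
Local Notation half := (@half R d M).
Implicit Types (f h : C) (X Y Z : XM).

Variables (g : XM -> XM -> C) (t : contactData M).
Hypothesis acm : almost_contact_metric g t.
Local Notation phi := (cphi t).
Local Notation xi := (cxi t).
Local Notation eta := (ceta t).

Let gm := acm_metric acm.
Let gE := (metricDl gm, metricDr gm, metricZl gm, metricZr gm, metricNl gm,
           metricNr gm).

Lemma phiD X Y : phi (X + Y) = phi X + phi Y.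
Proof. exact: tensorD (acm_phi_lin acm) X Y. Qed.
Lemma phi0 : phi 0 = 0. Proof. exact: tensor0 (acm_phi_lin acm). Qed.
Lemma phiZ f X : phi (f *: X) = f *: phi X.
Proof. exact: tensorZ (acm_phi_lin acm) f X. Qed.
Lemma phiN X : phi (- X) = - phi X.
Proof. exact: tensorN (acm_phi_lin acm) X. Qed.

Lemma etaD X Y : eta (X + Y) = eta X + eta Y.
Proof. exact: (tensorD (W := C^o) (acm_eta_lin acm)) X Y. Qed.
Lemma eta0 : eta 0 = 0. Proof. exact: (tensor0 (W := C^o) (acm_eta_lin acm)). Qed.
Lemma etaZ f X : eta (f *: X) = f * eta X.
Proof. exact: (tensorZ (W := C^o) (acm_eta_lin acm)) f X. Qed.
Lemma etaN X : eta (- X) = - eta X.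
Proof. exact: (tensorN (W := C^o) (acm_eta_lin acm)) X. Qed.

(** Since phi^2 xi = 0, the formula for phi^2 at phi xi gives phi xi = a xi. Then a^2 = 0, and a
    real function of square zero vanishes. *)
Lemma phi_xi : phi xi = 0.
Proof.
have p2 : phi (phi xi) = 0 by rewrite (acm_phi2 acm) (acm_eta_xi acm) scale1r addNr.
have : phi (phi (phi xi)) = 0 by rewrite p2 phi0.
rewrite (acm_phi2 acm) => /eqP; rewrite addrC subr_eq0 => /eqP.
set a := eta (phi xi) => aE.
have : a * a = 0.
  have := congr1 (fun X => eta (phi X)) aE.
  by rewrite p2 eta0 phiZ etaZ.
move=> aa; suff a0 : a = 0 by rewrite -aE a0 scale0r.
apply: smoothFun_eq => q; have := congr1 (fun h : C => h q) aa.
by rewrite smoothM => /eqP; rewrite mulf_eq0 orbb => /eqP.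
Qed.

(** Two computations of phi^3 X, as phi(phi^2 X) and as phi^2(phi X), differ by eta(phi X) xi. *)
Lemma eta_phi X : eta (phi X) = 0.
Proof.
have : phi (phi (phi X)) = - phi X.
  by rewrite (acm_phi2 acm X) phiD phiN phiZ phi_xi scaler0 addr0.
rewrite (acm_phi2 acm (phi X)) => /eqP; rewrite -subr_eq0 addrAC subrr add0r => /eqP.
by move=> /(congr1 eta); rewrite etaZ (acm_eta_xi acm) mulr1 eta0.
Qed.

Lemma metric_xi X : g X xi = eta X.
Proof.
have := acm_compat acm X xi; rewrite phi_xi metric0r// (acm_eta_xi acm) mulr1.
by move=> /esym /eqP; rewrite subr_eq0 => /eqP.
Qed.

Lemma metric_phi X Y : g (phi X) Y = - g X (phi Y).
Proof.
have := acm_compat acm X (phi Y); rewrite eta_phi mulr0 subr0 => <-.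
by rewrite (acm_phi2 acm) !gE metric_xi eta_phi mulr0 addr0 opprK.
Qed.

Lemma ext_d1_lin1 f X X' Y :
  ext_d1 eta (f *: X + X') Y = f * ext_d1 eta X Y + ext_d1 eta X' Y.
Proof.
rewrite /ext_d1 bracketDl bracketZl !(etaD, etaZ, etaN) vectorDE vectorZE vfD vfM.
ring.
Qed.

Lemma ext_d1C X Y : ext_d1 eta Y X = - ext_d1 eta X Y.
Proof. by rewrite /ext_d1 (bracketC X Y) etaN; ring. Qed.

Lemma fundamental_form_lin1 f X X' Y : fundamental_form g t (f *: X + X') Y =
  f * fundamental_form g t X Y + fundamental_form g t X' Y.
Proof. by rewrite /fundamental_form !gE. Qed.

Lemma fundamental_formC X Y : fundamental_form g t Y X = - fundamental_form g t X Y.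
Proof. by rewrite /fundamental_form -metric_phi (metricC gm). Qed.

(** For a Killing field the Levi-Civita connection satisfies 2 g(nabla_X xi, Z) = d eta(X, Z). *)
Lemma koszul_xi X Z : killing g xi -> koszul g X xi Z = ext_d1 eta X Z.
Proof.
move=> K; rewrite /koszul /ext_d1 (metricC gm xi Z) !metric_xi (K X Z).
by rewrite (bracketC xi X) !gE (metricC gm X); ring.
Qed.

(** This is g((nabla_X phi) Y, Z), with the outer phi moved to Z by skewness. *)
Definition nabla_phi (nabla : XM -> XM -> XM) X Y Z : C :=
  g (nabla X (phi Y)) Z + g (nabla X Y) (phi Z).

Lemma nabla_phiE nabla X Y Z :
  nabla_phi nabla X Y Z = g (nabla X (phi Y) - phi (nabla X Y)) Z.
Proof. by rewrite /nabla_phi !gE metric_phi opprK. Qed.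

Section Connection.
Variable nabla : XM -> XM -> XM.
Hypothesis nm : metric_connection g nabla.
Local Notation T X Y Z := (g (torsion nabla X Y) Z).
Local Notation P := (nabla_phi nabla).

Let nD X Y Y' : nabla X (Y + Y') = nabla X Y + nabla X Y'.
Proof. by case: nm => -[]. Qed.
Let nL X f Y : nabla X (f *: Y) = (X f : C) *: Y + f *: nabla X Y.
Proof. by case: nm => -[]. Qed.
Let nN X Y : nabla X (- Y) = - nabla X Y.
Proof.
by rewrite -[- Y]scaleN1r nL vfN vf1 oppr0 scale0r add0r scaleN1r.
Qed.
Let nlin f X X' Y : nabla (f *: X + X') Y = f *: nabla X Y + nabla X' Y.
Proof. by case: nm => -[]. Qed.
Let nmetric X Y Z : X (g Y Z) = g (nabla X Y) Z + g Y (nabla X Z).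
Proof. by case: nm. Qed.

Lemma bracket_torsion X Y Z :
  g [v X, Y] Z = g (nabla X Y) Z - g (nabla Y X) Z - T X Y Z.
Proof. by rewrite /torsion !gE; ring. Qed.

Lemma nabla_phi_lin1 f X X' Y Z : P (f *: X + X') Y Z = f * P X Y Z + P X' Y Z.
Proof. by rewrite /nabla_phi !nlin !gE; ring. Qed.

Lemma nabla_phi_lin2 f X Y Y' Z : P X (f *: Y + Y') Z = f * P X Y Z + P X Y' Z.
Proof.
rewrite /nabla_phi phiD phiZ !(nD, nL) !gE metric_phi; ring.
Qed.

Lemma nabla_phi_skew X Y Z : P X Z Y = - P X Y Z.
Proof.
apply/eqP; rewrite -addr_eq0; apply/eqP.
have H : X (g (phi Y) Z) = - X (g Y (phi Z)) :> C by rewrite metric_phi vfN.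
move: H; rewrite !nmetric => H; rewrite /nabla_phi.
transitivity (g (nabla X (phi Y)) Z + g (phi Y) (nabla X Z) +
              (g (nabla X Y) (phi Z) + g Y (nabla X (phi Z)))).
  rewrite (metricC gm Y) (metricC gm (phi Y)); ring.
by rewrite H addNr.
Qed.

Lemma nabla_phi_lin3 f X Y Z Z' : P X Y (f *: Z + Z') = f * P X Y Z + P X Y Z'.
Proof.
by rewrite nabla_phi_skew nabla_phi_lin2 (nabla_phi_skew X Y Z)
  (nabla_phi_skew X Y Z'); ring.
Qed.

(** For a torsion-free connection dPhi is the cyclic sum of nabla Phi, and (nabla_X Phi)(Y, Z) = - P
    X Y Z. *)
Lemma ext_d2_nabla_phi X Y Z :
  (forall X Y Z, T X Y Z = 0) ->
  ext_d2 (fundamental_form g t) X Y Z = - (P X Y Z + P Y Z X + P Z X Y).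
Proof.
move=> T0; rewrite (nabla_phi_skew X Z Y) (nabla_phi_skew Z Y X).
rewrite /ext_d2 /fundamental_form !nmetric !bracket_torsion !T0 /nabla_phi.
rewrite (metricC gm Y) !(metricC gm X); ring.
Qed.

(** Torsion-freeness replaces brackets by covariant derivatives; Z in the kernel of eta removes the
    terms along xi. *)
Lemma nijenhuis_nabla_phi X Y Z : (forall X Y Z, T X Y Z = 0) -> eta Z = 0 ->
  nijenhuis3 g t X Y Z =
  P (phi X) Y Z - P (phi Y) X Z - P Y X (phi Z) + P X Y (phi Z).
Proof.
move=> T0 Z0; rewrite /nijenhuis3 /nijenhuis !gE !metric_phi !(metricC gm xi).
rewrite metric_xi Z0 mulr0 addr0 /nabla_phi (acm_phi2 acm Z) Z0 scale0r addr0.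
rewrite !gE !bracket_torsion !T0; ring.
Qed.

Section Horizontal.
Variable H : set XM.
Hypotheses (Hphi : forall X, H X -> H (phi X)) (Heta : forall X, H X -> eta X = 0).

Let phi2H X : H X -> phi (phi X) = - X.
Proof. by move=> /Heta X0; rewrite (acm_phi2 acm) X0 scale0r addr0. Qed.

Let P1N X Y Z : P (- X) Y Z = - P X Y Z.
Proof. by rewrite (tensorN (W := C^o) (u := fun X => P X Y Z))// => *; exact: nabla_phi_lin1. Qed.

Let P2N X Y Z : P X (- Y) Z = - P X Y Z.
Proof. by rewrite (tensorN (W := C^o) (u := fun Y => P X Y Z))// => *; exact: nabla_phi_lin2. Qed.

Let P3N X Y Z : P X Y (- Z) = - P X Y Z.
Proof. by rewrite (tensorN (W := C^o) (u := fun Z => P X Y Z))// => *; exact: nabla_phi_lin3. Qed.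

Let P_phi X Y Z : H Y -> H Z -> P X (phi Y) Z = P X Y (phi Z).
Proof. by move=> HY HZ; rewrite /nabla_phi !phi2H// nN !gE; ring. Qed.

Let P_phi2 X Y Z : H Y -> H Z -> P X (phi Y) (phi Z) = - P X Y Z.
Proof. by move=> HY HZ; rewrite P_phi ?phi2H ?P3N//; exact: Hphi. Qed.

(** If B is the horizontal torsion, this says that adding B/2 to the Levi-Civita connection makes
    phi parallel on H. Once N and dPhi are written through P, the identity reduces to one instance
    of skewness of N, exchanging Y and phi Z. *)
Lemma horizontal_nabla_phi X Y Z :
  (forall X Y Z, T X Y Z = 0) -> three_form_on H (nijenhuis3 g t) ->
  H X -> H Y -> H Z ->
  let B X Y Z := nijenhuis3 g t X Y Z -
    ext_d2 (fundamental_form g t) (phi X) (phi Y) (phi Z) in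
  P X Y Z + P X Y Z + B X (phi Y) Z + B X Y (phi Z) = 0.
Proof.
move=> T0 N3 HX HY HZ /=.
have HfX := Hphi HX; have HfY := Hphi HY; have HfZ := Hphi HZ.
have N23 := form_skew23 N3 HX HfZ HY.
rewrite !nijenhuis_nabla_phi ?Heta// in N23.
rewrite !nijenhuis_nabla_phi ?Heta// !ext_d2_nabla_phi//.
rewrite !phi2H// ?(P1N, P2N, P3N) in N23 *.
rewrite !P_phi2// (nabla_phi_skew (phi X) Y (phi Z)) (nabla_phi_skew X Y Z) in N23.
rewrite !P_phi2// (P_phi (phi X) HY HZ) (P_phi (phi Z) HX HY).
rewrite (nabla_phi_skew (phi Y) (phi X) Z) (P_phi (phi Y) HX HZ) (nabla_phi_skew Y X Z).
move/eqP: N23; rewrite -subr_eq0 => /eqP N23; rewrite -[RHS]N23; ring.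
Qed.

End Horizontal.

End Connection.

Lemma nijenhuis_three_form nabla : characteristic_connection g t nabla ->
  three_form (nijenhuis3 g t).
Proof.
case=> aff metr skew eta_par phi_par.
have nm : metric_connection g nabla by split.
pose T X Y Z := g (torsion nabla X Y) Z.
have NE X Y Z : nijenhuis3 g t X Y Z =
    T X Y Z - T (phi X) (phi Y) Z - T (phi X) Y (phi Z) - T X (phi Y) (phi Z).
  (* Parallelism lets phi and eta pass through [nabla]; the covariant derivatives then cancel and
     only torsion terms remain. *)
  have nphi (A B W : XM) : g (nabla A (phi B)) W = - g (nabla A B) (phi W).
    by rewrite -metric_phi; congr (g _ W); apply/eqP; rewrite -subr_eq0 phi_par.
  have neta (A B : XM) : A (eta B) = g (nabla A B) xi.
    by rewrite metric_xi; apply/eqP; rewrite -subr_eq0 eta_par.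
  have phi2Z A : g A (phi (phi Z)) = - g A Z + eta Z * g A xi.
    by rewrite (acm_phi2 acm) !gE.
  have nphi2 A B : g (nabla A (phi B)) (phi Z) =
      g (nabla A B) Z - eta Z * g (nabla A B) xi by rewrite nphi phi2Z; ring.
  rewrite /nijenhuis3 /nijenhuis /ext_d1 !gE !metric_phi !phi2Z !neta.
  rewrite -(metric_xi [v X, Y]) (metricC gm xi Z) (metric_xi Z).
  rewrite !(bracket_torsion nabla) !nphi2 !nphi /T; ring.
have [T1 T2 T3 T12 T23] : three_form T := skew.
clearbody T.
split=> [f X X' Y Z _ _ _ _|f X Y Y' Z _ _ _ _|f X Y Z Z' _ _ _ _|X Y Z _ _ _|X Y Z _ _ _].
- by rewrite !NE !(phiD, phiZ) !T1//; ring.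
- by rewrite !NE !(phiD, phiZ) !T2//; ring.
- by rewrite !NE !(phiD, phiZ) !T3//; ring.
- by rewrite !NE (T12 X Y Z)// (T12 (phi X) (phi Y) Z)// (T12 X (phi Y) (phi Z))//
    (T12 (phi X) Y (phi Z))//; ring.
- by rewrite !NE (T23 X Y Z)// (T23 (phi X) (phi Y) Z)// (T23 X (phi Y) (phi Z))//
    (T23 (phi X) Y (phi Z))//; ring.
Qed.

(* The characteristic connection has torsion that of nabla minus
   beta (eta /\ Phi). *)
Lemma characteristic_of_sasaki_like nabla (beta : C) :
  metric_connection g nabla ->
  three_form (fun X Y Z => g (torsion nabla X Y) Z) ->
  (forall X, nabla X xi = (half * beta) *: phi X) ->
  (forall X Y Z, nabla_phi nabla X Y Z =
     half * beta * (eta Y * g X Z - g X Y * eta Z)) ->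
  admits_characteristic_connection g t.
Proof.
move=> nm skew nxi nphi; have [[nlin nadd nleib] nmetric] := nm.
set b := half * beta in nxi nphi.
pose F := fundamental_form g t.
(* The correction is - b (eta /\ Phi) with its last argument raised by g. Being skew, it enters the
   torsion twice, and b + b = beta. *)
pose nabla' X Y := nabla X Y + b *: (eta X *: phi Y - eta Y *: phi X - F X Y *: xi).
have nE X Y Z : g (nabla' X Y) Z = g (nabla X Y) Z +
    b * (- eta X * F Y Z + eta Y * F X Z - F X Y * eta Z).
  by rewrite /nabla' !gE !metric_phi (metricC gm xi) metric_xi /F /fundamental_form; ring.
clearbody nabla'.
have FC X Y : F Y X = - F X Y by exact: fundamental_formC.
have Fxi X : F X xi = 0 by rewrite /F /fundamental_form phi_xi metric0r.
have Fphi X Y : F X (phi Y) = - g X Y + eta X * eta Y.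
  by rewrite /F /fundamental_form (acm_phi2 acm) !gE metric_xi mulrC.
have TE X Y Z : g (torsion nabla' X Y) Z = g (torsion nabla X Y) Z -
    (b + b) * (eta X * F Y Z - eta Y * F X Z + eta Z * F X Y).
  by rewrite /torsion !gE !nE (FC X Y); ring.
have FD X Y Z : F (X + Y) Z = F X Z + F Y Z by rewrite /F /fundamental_form !gE.
have FZ f X Z : F (f *: X) Z = f * F X Z by rewrite /F /fundamental_form !gE.
have FDr X Y Z : F Z (X + Y) = F Z X + F Z Y by rewrite /F /fundamental_form phiD !gE.
have FZr f X Z : F Z (f *: X) = f * F Z X by rewrite /F /fundamental_form phiZ !gE.
have eE := (etaD, etaZ, FD, FZ, FDr, FZr).
exists nabla'; split.
- split.
  + move=> f X X' Y; apply: (metric_inj gm) => Z; rewrite !gE !nE nlin !eE !gE; ring.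
  + move=> X Y Y'; apply: (metric_inj gm) => Z; rewrite !gE !nE nadd !eE !gE; ring.
  + move=> X f Y; apply: (metric_inj gm) => Z; rewrite !gE !nE nleib !eE !gE; ring.
- move=> X Y Z; rewrite (metricC gm Y (nabla' X Z)) !nE nmetric.
  by rewrite (metricC gm Y (nabla X Z)) (FC Y Z); ring.
- have [T1 T2 T3 T12 T23] := skew.
  split=> [f X X' Y Z _ _ _ _|f X Y Y' Z _ _ _ _|f X Y Z Z' _ _ _ _|X Y Z _ _ _|X Y Z _ _ _];
    rewrite !TE.
  + by rewrite T1// !eE; ring.
  + by rewrite T2// !eE; ring.
  + by rewrite T3// !eE; ring.
  + by rewrite T12// (FC X Y); ring.
  + by rewrite T23// (FC Y Z); ring.
- move=> X Y; rewrite -!metric_xi nmetric nE nxi !gE Fxi (acm_eta_xi acm).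
  rewrite -(Fxi X) /F /fundamental_form.
  rewrite (metricC gm Y) metric_phi phi_xi metric0r//; ring.
- move=> X Y; apply: (metric_inj gm) => Z; rewrite metric0l// !gE metric_phi !nE.
  have -> : g (nabla X (phi Y)) Z =
      b * (eta Y * g X Z - g X Y * eta Z) - g (nabla X Y) (phi Z).
    by rewrite -nphi /nabla_phi addrK.
  rewrite !eta_phi (FC Z (phi Y)) !Fphi (metricC gm Z Y); ring.
Qed.

End AlmostContact.

(** * Almost 3-contact metric structures *)

Lemma I3_cases (i : 'I_3) : [\/ i = 0, i = 1 | i = 2%:R].
Proof.
case: i => -[|[|[|//]]] ?; [apply: Or31|apply: Or32|apply: Or33]; exact: val_inj.
Qed.

Lemma even_triple_base : even_triple 0 1 2%:R.
Proof. by exists 1%g; rewrite ?odd_perm1 ?perm1. Qed.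

Lemma even_triple_rot i j k : even_triple i j k -> even_triple j k i.
Proof.
(* The product of the two transpositions is the 3-cycle 0 -> 1 -> 2 -> 0. *)
case=> sigma ev [<- <- <-]; exists (tperm (0 : 'I_3) 1%R * tperm (0 : 'I_3) 2%:R%R * sigma)%g.
  by rewrite !odd_permM !odd_tperm /= (negbTE ev).
by rewrite !permM !permE.
Qed.

Lemma even_triple_third (i j : 'I_3) : i != j -> exists k,
  even_triple i j k \/ even_triple j i k.
Proof.
have e0 := even_triple_base; have e1 := even_triple_rot e0.
have e2 := even_triple_rot e1.
case: (I3_cases i) => ->; case: (I3_cases j) => -> //.
- by exists 2%:R; left.
- by exists 1; right.
- by exists 2%:R; right.
- by exists 0; left.
- by exists 1; left.
- by exists 0; right.
Qed.

Section Almost3Contact.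
Context {R : realType} {d : nat} {M : smoothManifold R d}.
Local Notation C := (smoothFun M).
Local Notation XM := (vectorField M).
Local Notation half := (@half R d M).
Implicit Types (f h : C) (X Y Z : XM) (i j k : 'I_3).

Variables (g : XM -> XM -> C) (s : 'I_3 -> contactData M).
Hypothesis a3c : almost_3_contact_metric g s.

Local Notation phi i := (cphi (s i)).
Local Notation xi i := (cxi (s i)).
Local Notation eta i := (ceta (s i)).
Local Notation Phi i := (fundamental_form g (s i)).
Local Notation H := (horizontal s).

Let acm i : almost_contact_metric g (s i) := a3c_acm a3c i.
Let gm := acm_metric (acm 0).
Let gE := (metricDl gm, metricDr gm, metricZl gm, metricZr gm, metricNl gm,
           metricNr gm).

(** For i != j, eta_i is eta_k o phi_j up to sign, and phi_j xi_j = 0. *)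
Lemma eta_xi i j : eta i (xi j) = (i == j)%:R.
Proof.
have [->|ij] := eqVneq i j; first exact: acm_eta_xi (acm j).
have [k [/even_triple_rot E|/even_triple_rot/even_triple_rot E]] := even_triple_third ij.
  have [_ ->] := a3c_eta a3c E (xi j).
  by rewrite (phi_xi (acm j)) (eta0 (acm k)) oppr0.
have [-> _] := a3c_eta a3c E (xi j).
by rewrite (phi_xi (acm j)) (eta0 (acm k)).
Qed.

Lemma metric_xi_xi i j : g (xi i) (xi j) = (i == j)%:R.
Proof. by rewrite (metric_xi (acm j)) eta_xi eq_sym. Qed.

(* The two orientations of a pair i != j are treated at once, with the sign
   [e] of the permutation (i, j, k). *)
Lemma phi_cross i j : i != j -> exists (e : C) k,
  [/\ forall X, phi i (phi j X) = e *: phi k X + eta j X *: xi i,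
      forall X, phi j (phi i X) = (- e) *: phi k X + eta i X *: xi j,
      [/\ phi i (xi j) = e *: xi k, phi j (xi i) = (- e) *: xi k &
         forall X, X e = 0 :> C],
      forall X, eta i (phi j X) = e * eta k X &
      forall beta, reeb_killing_function g s beta -> forall X Y, H X -> H Y ->
        A_tensor g s i j X Y = e * beta * Phi k X Y].
Proof.
move=> ij; have [k [E|E]] := even_triple_third ij.
  exists 1, k; split=> [X|X||X|beta RK X Y HX HY].
  - by have [-> _] := a3c_phi a3c E X; rewrite scale1r subrK.
  - by have [_ ->] := a3c_phi a3c E X; rewrite scaleN1r opprD opprK addrNK.
  - have [E1 E2] := a3c_xi a3c E; rewrite scale1r scaleN1r; split=> //.
      by rewrite E2 opprK.
    exact: vf1.
  - by have [-> _] := a3c_eta a3c E X; rewrite mul1r.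
  - by have [_ /(_ i j k E)[-> _]] := RK X Y HX HY; rewrite mul1r.
exists (-1), k; split=> [X|X||X|beta RK X Y HX HY].
- by have [_ ->] := a3c_phi a3c E X; rewrite scaleN1r opprD opprK addrNK.
- by have [-> _] := a3c_phi a3c E X; rewrite opprK scale1r subrK.
- have [E1 E2] := a3c_xi a3c E; rewrite opprK scale1r scaleN1r; split=> //.
    by rewrite E2 opprK.
  by move=> X; rewrite vfN vf1 oppr0.
- by have [_ ->] := a3c_eta a3c E X; rewrite mulN1r opprK.
- have [_ /(_ j i k E)[_ E']] := RK X Y HX HY.
  by rewrite mulN1r mulNr -E' opprK.
Qed.

Lemma horizontal_phi i X : H X -> H (phi i X).
Proof.
move=> HX j; have [->|ji] := eqVneq j i; first exact: eta_phi (acm i) X.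
by have [e [k [_ _ _ -> _]]] := phi_cross ji; rewrite HX mulr0.
Qed.

(** For i != j the two multiples of phi_k are opposite and cancel. This Clifford relation governs
    the square of a linear combination of the phi_i. *)
Lemma phi_anticomm i j X :
  phi i (phi j X) + phi j (phi i X) =
  eta j X *: xi i + eta i X *: xi j - ((i == j)%:R + (i == j)%:R) *: X.
Proof.
have [->|ij] := eqVneq i j.
  rewrite (acm_phi2 (acm j)) scalerDl scale1r opprD.
  by rewrite [LHS]addrACA [LHS]addrC.
have [e [k [-> -> _ _ _]]] := phi_cross ij.
by rewrite scaleNr addr0 scale0r subr0 addrACA subrr add0r.
Qed.

Definition vert X : XM := \sum_i eta i X *: xi i.
Definition hor X : XM := X - vert X.

Lemma vert_lin f X Y : vert (f *: X + Y) = f *: vert X + vert Y.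
Proof.
rewrite /vert scaler_sumr -big_split /=; apply: eq_bigr => i _.
by rewrite (etaD (acm i)) (etaZ (acm i)) scalerDl scalerA.
Qed.

Lemma hor_lin f X Y : hor (f *: X + Y) = f *: hor X + hor Y.
Proof. by rewrite /hor vert_lin scalerBr opprD addrACA. Qed.

Lemma horizontal_hor X : H (hor X).
Proof.
move=> i; rewrite /hor (etaD (acm i)) (etaN (acm i)) /vert.
rewrite (tensor_sum (W := C^o) (acm_eta_lin (acm i))) (bigD1 i)// big1 => [|j ji].
  by rewrite (etaZ (acm i)) eta_xi eqxx mulr1; rewrite [X in _ - X]addr0 subrr.
by rewrite (etaZ (acm i)) eta_xi eq_sym (negbTE ji) mulr0.
Qed.

Lemma hor_id X : H X -> hor X = X.
Proof.
by move=> HX; rewrite /hor /vert big1 ?subr0// => i _; rewrite HX scale0r.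
Qed.

Lemma vert_xi j : vert (xi j) = xi j.
Proof.
rewrite /vert (bigD1 j)// big1 => [|i ij].
  by rewrite eta_xi eqxx scale1r; exact: addr0.
by rewrite eta_xi (negbTE ij) scale0r.
Qed.

Lemma hor_xi j : hor (xi j) = 0.
Proof. by rewrite /hor vert_xi subrr. Qed.

Lemma sub_hor X : X - hor X = vert X.
Proof. by rewrite /hor opprB addrC subrK. Qed.

(** Each argument splits into vertical and horizontal parts, and skewness transfers the vertical
    case from the second argument to the third. Three cases remain. *)
Lemma trilinear_vanish (Q : XM -> XM -> XM -> C) :
  (forall f X X' Y Z, Q (f *: X + X') Y Z = f * Q X Y Z + Q X' Y Z) ->
  (forall f X Y Y' Z, Q X (f *: Y + Y') Z = f * Q X Y Z + Q X Y' Z) ->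
  (forall X Y Z, Q X Z Y = - Q X Y Z) ->
  (forall j X Z, Q X (xi j) Z = 0) ->
  (forall j Y Z, H Y -> H Z -> Q (xi j) Y Z = 0) ->
  (forall X Y Z, H X -> H Y -> H Z -> Q X Y Z = 0) ->
  forall X Y Z, Q X Y Z = 0.
Proof.
move=> Q1 Q2 Q23 Qv2 Qv1 Qh.
have Qvert2 X Y Z : Q X Y Z = Q X (hor Y) Z.
  rewrite -[Y in LHS](subrK (hor Y)) (tensorD (W := C^o) (u := fun Y => Q X Y Z))//.
  rewrite sub_hor /vert (tensor_sum (W := C^o) (u := fun Y => Q X Y Z))//.
  rewrite big1 ?add0r// => i _.
  by rewrite (tensorZ (W := C^o) (u := fun Y => Q X Y Z))// Qv2 scaler0.
have Qvert1 X Y Z : H Y -> H Z -> Q X Y Z = Q (hor X) Y Z.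
  move=> HY HZ.
  rewrite -[X in LHS](subrK (hor X)) (tensorD (W := C^o) (u := fun X => Q X Y Z))//.
  rewrite sub_hor /vert (tensor_sum (W := C^o) (u := fun X => Q X Y Z))//.
  rewrite big1 ?add0r// => i _.
  by rewrite (tensorZ (W := C^o) (u := fun X => Q X Y Z))// Qv1// scaler0.
move=> X Y Z; rewrite Qvert2 Q23 Qvert2 -Q23 Qvert1; try exact: horizontal_hor.
by apply: Qh; exact: horizontal_hor.
Qed.

(** * The associated sphere *)

Section Sphere.
Variable a : 'I_3 -> R.
Hypothesis a1 : \sum_i a i ^+ 2 = 1.

Local Notation c i := (smooth_cst M (a i)).

Definition sphere_structure : contactData M :=
  ContactData (fun X => \sum_i c i *: phi i X) (\sum_i c i *: xi i)
              (fun X => \sum_i c i * eta i X).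
Local Notation phia := (cphi sphere_structure).
Local Notation xia := (cxi sphere_structure).
Local Notation etaa := (ceta sphere_structure).

Let sum_c2 : \sum_i c i * c i = 1.
Proof.
by apply: smoothFun_eq => q; rewrite smooth_sum -[RHS]a1.
Qed.

Let metric_xia X : g X xia = etaa X.
Proof.
rewrite (metric_sumr gm); apply: eq_bigr => i _.
by rewrite (metricZr gm) (metric_xi (acm i)).
Qed.

Let metric_phia X Y : g (phia X) Y = - g X (phia Y).
Proof.
rewrite (metric_suml gm) (metric_sumr gm) -sumrN; apply: eq_bigr => i _.
by rewrite (metricZl gm) (metricZr gm) (metric_phi (acm i)) mulrN.
Qed.

Let phia2 X : phia (phia X) = - X + etaa X *: xia.
Proof.
pose S := \sum_i \sum_j (c i * c j) *: phi i (phi j X).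
have -> : phia (phia X) = S.
  apply: eq_bigr => i _; rewrite (tensor_sum (acm_phi_lin (acm i))) scaler_sumr.
  by apply: eq_bigr => j _; rewrite (phiZ (acm i)) scalerA.
(* Doubling S pairs the terms (i, j) and (j, i), to which [phi_anticomm] applies. *)
have SS : S + S = (- X + etaa X *: xia) + (- X + etaa X *: xia).
  rewrite {2}/S exchange_big -big_split /=.
  have E i : \sum_j (c i * c j) *: phi i (phi j X) +
      \sum_j (c j * c i) *: phi j (phi i X) =
      etaa X *: (c i *: xi i) + (c i * eta i X) *: xia - (c i * c i + c i * c i) *: X.
    rewrite -big_split /=.
    under eq_bigr do rewrite (mulrC (c _) (c i)) -scalerDr phi_anticomm
      scalerBr scalerDr !scalerA.
    rewrite sumrB big_split /=; congr (_ + _ - _).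
    - rewrite scaler_suml; apply: eq_bigr => j _; rewrite scalerA; congr (_ *: _).
      ring.
    - rewrite scaler_sumr; apply: eq_bigr => j _; rewrite scalerA; congr (_ *: _).
      ring.
    - rewrite (bigD1 i)// big1 => [|j ji].
        by rewrite eqxx mulr1n mulrDr mulr1; exact: addr0.
      by rewrite eq_sym (negbTE ji) mulr0n addr0 mulr0 scale0r.
  under eq_bigr do rewrite E.
  rewrite sumrB big_split /= -scaler_sumr -scaler_suml -scaler_suml big_split /=.
  rewrite sum_c2 scalerDl scale1r opprD.
  by rewrite [LHS]addrACA ![_ - X]addrC.
have h2 (V : XM) : V = half *: (V + V).
  by rewrite scalerDr -scalerDl half_double scale1r.
by rewrite [LHS]h2 SS -h2.
Qed.

Lemma sphere_acm : almost_contact_metric g sphere_structure.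
Proof.
split=> //.
- move=> f X Y; rewrite /= scaler_sumr -big_split; apply: eq_bigr => i _ /=.
  by rewrite (acm_phi_lin (acm i)) scalerDr !scalerA mulrC.
- move=> f X Y; rewrite /= mulr_sumr -big_split; apply: eq_bigr => i _ /=.
  by rewrite (acm_eta_lin (acm i)); ring.
- rewrite -[RHS]sum_c2; apply: eq_bigr => i _; congr (_ * _).
  rewrite (tensor_sum (W := C^o) (acm_eta_lin (acm i))) (bigD1 i)// big1 => [|j ji].
    by rewrite (etaZ (acm i)) eta_xi eqxx mulr1; exact: addr0.
  by rewrite (etaZ (acm i)) eta_xi eq_sym (negbTE ji) mulr0.
- move=> X Y; rewrite metric_phia phia2 (metricDr gm) (metricNr gm) (metricZr gm).
  by rewrite metric_xia; ring.
Qed.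

(** The coefficients are constant, so [nabla] passes through the combination without derivative
    terms. *)
Lemma sphere_nabla_phi nabla X Y Z : metric_connection g nabla ->
  nabla_phi g sphere_structure nabla X Y Z =
  \sum_i c i * nabla_phi g (s i) nabla X Y Z.
Proof.
case=> -[_ nadd nleib] _; rewrite /nabla_phi /=.
have n0 : nabla X 0 = 0 by apply: (addrI (nabla X 0)); rewrite -nadd !addr0.
rewrite (big_morph (nabla X) (nadd X) n0) (metric_suml gm) (metric_sumr gm).
rewrite -big_split; apply: eq_bigr => i _ /=.
by rewrite nleib vf_cst scale0r add0r (metricZl gm) (metricZr gm); ring.
Qed.

Lemma sphere_nabla_xi nabla X : metric_connection g nabla ->
  nabla X xia = \sum_i c i *: nabla X (xi i).
Proof.
case=> -[_ nadd nleib] _ /=.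
have n0 : nabla X 0 = 0 by apply: (addrI (nabla X 0)); rewrite -nadd !addr0.
rewrite (big_morph (nabla X) (nadd X) n0); apply: eq_bigr => i _.
by rewrite nleib vf_cst scale0r add0r.
Qed.

End Sphere.

End Almost3Contact.

(** * The torsion and the connection of a canonical structure *)

Section Canonical.
Context {R : realType} {d : nat} {M : smoothManifold R d}.
Local Notation C := (smoothFun M).
Local Notation XM := (vectorField M).
Local Notation "[v X , Y ]" := (lie_bracket X Y) (at level 0).
Local Notation half := (@half R d M).
Implicit Types (f h : C) (X Y Z : XM) (i j k : 'I_3).

Variables (g : XM -> XM -> C) (s : 'I_3 -> contactData M).
Hypothesis a3c : almost_3_contact_metric g s.

Local Notation phi i := (cphi (s i)).
Local Notation xi i := (cxi (s i)).
Local Notation eta i := (ceta (s i)).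
Local Notation Phi i := (fundamental_form g (s i)).
Local Notation H := (horizontal s).
Local Notation hor := (hor s).

Let acm i : almost_contact_metric g (s i) := a3c_acm a3c i.
Let gm := acm_metric (acm 0).
Let gE := (metricDl gm, metricDr gm, metricZl gm, metricZr gm, metricNl gm,
           metricNr gm).

Hypothesis can : canonical_3_contact g s.
Variable beta : C.
Hypothesis RK : reeb_killing_function g s beta.

Let K i := canonical_killing can i.

(** With this torsion [connection_of_torsion] gives the Levi-Civita connection. *)
Lemma trivial_three_form : three_form (fun _ _ _ : XM => 0 : C).
Proof. by split=> *; rewrite ?mulr0 ?addr0 ?oppr0. Qed.

(** The form T(xi_i, ., .) forced by nabla_X xi_i = (beta/2) phi_i X, since 2 g(nabla_X xi_i, Z) = d
    eta_i(X, Z) - T(xi_i, X, Z). *)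
Definition reeb_form i X Y : C := ext_d1 (eta i) X Y + beta * Phi i X Y.
Local Notation theta := reeb_form.

Lemma reeb_form_lin1 i f X X' Y :
  theta i (f *: X + X') Y = f * theta i X Y + theta i X' Y.
Proof.
by rewrite /theta (ext_d1_lin1 (acm i)) (fundamental_form_lin1 (acm i)); ring.
Qed.

Lemma reeb_formC i X Y : theta i Y X = - theta i X Y.
Proof. by rewrite /theta (ext_d1C (acm i) X Y) (fundamental_formC (acm i) X Y); ring. Qed.

Lemma reeb_form_lin2 i f X Y Y' :
  theta i X (f *: Y + Y') = f * theta i X Y + theta i X Y'.
Proof. by rewrite reeb_formC reeb_form_lin1 (reeb_formC i X Y) (reeb_formC i X Y'); ring. Qed.

(** The consistency condition for T: T(xi_i, xi_j, Z) must be skew in i and j. The d eta part is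
    skew because g(xi_i, xi_j) is constant, the Phi part because phi_i xi_j = - phi_j xi_i. *)
Lemma reeb_form_xi i j Z : theta i (xi j) Z + theta j (xi i) Z = 0.
Proof.
have dE a b : ext_d1 (eta a) (xi b) Z = - koszul g Z (xi a) (xi b).
  by rewrite (koszul_xi (acm a))// (ext_d1C (acm a) Z).
have -> : theta i (xi j) Z + theta j (xi i) Z =
    ext_d1 (eta i) (xi j) Z + ext_d1 (eta j) (xi i) Z +
    beta * (Phi i (xi j) Z + Phi j (xi i) Z) by rewrite /theta; ring.
have -> : ext_d1 (eta i) (xi j) Z + ext_d1 (eta j) (xi i) Z = 0.
  rewrite !dE -opprD (koszul_metric gm) (metric_xi_xi a3c).
  have -> : Z (i == j)%:R = 0 by case: (i == j); [exact: vf1|exact: vf0].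
  by rewrite addr0 oppr0.
rewrite /fundamental_form -(metricC gm (phi i Z)) -(metricC gm (phi j Z)).
rewrite (metric_phi (acm i)) (metric_phi (acm j)).
have [->|ij] := eqVneq i j.
  by rewrite (phi_xi (acm j)) (metric0r gm); ring.
have [e [k [_ _ [-> -> _] _ _]]] := phi_cross a3c ij.
by rewrite !gE; ring.
Qed.

(** [reeb_form_xi] contracted with eta_i(X) eta_j(Y); this is the possible defect of skewness of
    [mixed_torsion]. *)
Lemma reeb_form_vert X Y Z :
  \sum_i (eta i X * theta i (vert s Y) Z + eta i Y * theta i (vert s X) Z) = 0.
Proof.
have E i W : theta i (vert s W) Z = \sum_j eta j W * theta i (xi j) Z.
  have tl f X' Y' := reeb_form_lin1 i f X' Y' Z.
  rewrite /vert (tensor_sum (W := C^o) (u := (theta i)^~ Z) tl).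
  apply: eq_bigr => j _.
  by rewrite (tensorZ (W := C^o) (u := (theta i)^~ Z) tl).
rewrite big_split /=; under eq_bigr do rewrite E mulr_sumr.
under [X in _ + X]eq_bigr do rewrite E mulr_sumr.
rewrite [X in _ + X]exchange_big -big_split big1 //= => i _.
rewrite -big_split big1 //= => j _.
have -> : eta i X * (eta j Y * theta i (xi j) Z) + eta j Y * (eta i X * theta j (xi i) Z) =
    eta i X * eta j Y * (theta i (xi j) Z + theta j (xi i) Z) by ring.
by rewrite reeb_form_xi mulr0.
Qed.

(* With [reeb_form i] = T(xi_i, ., .), this is T(X, Y, Z) - T(hX, hY, hZ). *)
Definition mixed_torsion X Y Z : C :=
  \sum_i (eta i X * theta i Y Z + eta i Y * theta i Z (hor X)
          + eta i Z * theta i (hor X) (hor Y)).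

Let reebE := (reeb_form_lin1, reeb_form_lin2).

Lemma mixed_torsion_three_form : three_form mixed_torsion.
Proof.
have sumlin f (F G L : 'I_3 -> C) : (forall i, F i = f * G i + L i) ->
    \sum_i F i = f * \sum_i G i + \sum_i L i.
  by move=> FE; rewrite mulr_sumr -big_split; exact: eq_bigr.
have sumopp (F G : 'I_3 -> C) : \sum_i (F i + G i) = 0 -> \sum_i F i = - \sum_i G i.
  by rewrite big_split /= => /eqP; rewrite addr_eq0 => /eqP.
have hlin := hor_lin a3c.
have thor i X Z : theta i X Z - theta i (hor X) Z = theta i (vert s X) Z.
  have -> : vert s X = -1 *: hor X + X by rewrite scaleN1r addrC sub_hor.
  by rewrite reeb_form_lin1; ring.
split=> [f X X' Y Z _ _ _ _|f X Y Y' Z _ _ _ _|f X Y Z Z' _ _ _ _|X Y Z _ _ _|X Y Z _ _ _].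
- apply: sumlin => i; rewrite hlin !reebE (etaD (acm i)) (etaZ (acm i)); ring.
- apply: sumlin => i; rewrite hlin !reebE (etaD (acm i)) (etaZ (acm i)); ring.
- apply: sumlin => i; rewrite !reebE (etaD (acm i)) (etaZ (acm i)); ring.
- apply: sumopp; rewrite -[RHS](reeb_form_vert X Y Z).
  apply: eq_bigr => i _; rewrite -!thor.
  rewrite (reeb_formC i (hor X) Z) (reeb_formC i (hor Y) Z).
  by rewrite (reeb_formC i (hor X) (hor Y)); ring.
- apply: sumopp; rewrite -[RHS](reeb_form_vert Z Y (hor X)).
  apply: eq_bigr => i _; rewrite -!thor.
  rewrite (reeb_formC i (hor X) (hor Z)) (reeb_formC i (hor X) (hor Y)).
  by rewrite (reeb_formC i Y Z); ring.
Qed.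

Definition horizontal_torsion i X Y Z : C :=
  nijenhuis3 g (s i) X Y Z - ext_d2 (Phi i) (phi i X) (phi i Y) (phi i Z).

(** The Levi-Civita connection turns the bracket formula into a cyclic sum of tensors, where
    linearity over functions is visible. *)
Lemma fundamental_ext_d2 i : three_form (ext_d2 (Phi i)).
Proof.
have [nabla [nm tors _]] := connection_of_torsion gm trivial_three_form.
have dE X Y Z := ext_d2_nabla_phi (acm i) nm X Y Z tors.
have P1 := nabla_phi_lin1 (acm i) nm; have P2 := nabla_phi_lin2 (acm i) nm.
have P3 := nabla_phi_lin3 (acm i) nm; have PC := nabla_phi_skew (acm i) nm.
split=> [f X X' Y Z _ _ _ _|f X Y Y' Z _ _ _ _|f X Y Z Z' _ _ _ _|X Y Z _ _ _|X Y Z _ _ _];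
  rewrite !dE.
- by rewrite P1 P2 P3; ring.
- by rewrite P1 P2 P3; ring.
- by rewrite P1 P2 P3; ring.
- by rewrite (PC X Y Z) (PC Y X Z) (PC Z X Y); ring.
- by rewrite (PC X Y Z) (PC Y X Z) (PC Z X Y); ring.
Qed.

Lemma horizontal_torsion_three_form i : three_form_on H (horizontal_torsion i).
Proof.
have [N1 N2 N3 N12 N23] := canonical_N_skew can i.
have [D1 D2 D3 D12 D23] := fundamental_ext_d2 i.
have pE := (phiD (acm i), phiZ (acm i)).
split=> [f X X' Y Z HX HX' HY HZ|f X Y Y' Z HX HY HY' HZ|f X Y Z Z' HX HY HZ HZ'
  |X Y Z HX HY HZ|X Y Z HX HY HZ]; rewrite /horizontal_torsion ?pE.
- by rewrite N1// D1//; ring.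
- by rewrite N2// D2//; ring.
- by rewrite N3// D3//; ring.
- by rewrite N12// D12//; ring.
- by rewrite N23// D23//; ring.
Qed.

(** The index 0 is an arbitrary choice: by [canonical_N_dPhi] the horizontal part is the same for
    all i. *)
Definition sasaki_like_torsion X Y Z : C :=
  horizontal_torsion 0 (hor X) (hor Y) (hor Z) + mixed_torsion X Y Z.
Local Notation T0 := sasaki_like_torsion.

Lemma sasaki_like_torsion_three_form : three_form T0.
Proof.
have [N1 N2 N3 N12 N23] := horizontal_torsion_three_form 0.
have [D1 D2 D3 D12 D23] := mixed_torsion_three_form.
have hlin := hor_lin a3c; have Hh X := horizontal_hor a3c X.
split=> [f X X' Y Z _ _ _ _|f X Y Y' Z _ _ _ _|f X Y Z Z' _ _ _ _|X Y Z _ _ _|X Y Z _ _ _];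
  rewrite /sasaki_like_torsion ?hlin.
- by rewrite N1// D1//; ring.
- by rewrite N2// D2//; ring.
- by rewrite N3// D3//; ring.
- by rewrite N12// D12//; ring.
- by rewrite N23// D23//; ring.
Qed.

Lemma sasaki_like_torsion_xi i Y Z : T0 (xi i) Y Z = theta i Y Z.
Proof.
have theta0 j W : theta j 0 W = 0.
  exact: (tensor0 (W := C^o) (u := (theta j)^~ W) (fun f X X' => reeb_form_lin1 j f X X' W)).
rewrite /T0 (hor_xi a3c).
have -> : horizontal_torsion 0 0 (hor Y) (hor Z) = 0.
  have [N1 _ _ _ _] := horizontal_torsion_three_form 0.
  have H0 : H 0 by move=> j; rewrite (eta0 (acm j)).
  have := N1 1 0 0 (hor Y) (hor Z) H0 H0 (horizontal_hor a3c Y) (horizontal_hor a3c Z).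
  rewrite scaler0 addr0 mul1r => /eqP; rewrite -subr_eq0 opprD addrA subrr sub0r.
  by rewrite oppr_eq0 => /eqP.
rewrite add0r /mixed_torsion (hor_xi a3c) (bigD1 i)// big1 => [|j ji].
  rewrite (eta_xi a3c) eqxx mulr1n (reeb_formC i 0 Z) !theta0 -[RHS]addr0.
  by congr (_ + _); ring.
by rewrite (eta_xi a3c) (negbTE ji) mulr0n (reeb_formC j 0 Z) !theta0; ring.
Qed.

Lemma sasaki_like_torsion_horizontal i X Y Z : H X -> H Y -> H Z ->
  T0 X Y Z = horizontal_torsion i X Y Z.
Proof.
move=> HX HY HZ; rewrite /T0 !hor_id// /mixed_torsion big1 => [|j _].
  by rewrite addr0; exact: (canonical_N_dPhi can).
by rewrite HX HY HZ; ring.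
Qed.

Theorem sasaki_like_connection : exists nabla,
  [/\ metric_connection g nabla,
    three_form (fun X Y Z => g (torsion nabla X Y) Z),
    forall i X, nabla X (xi i) = (half * beta) *: phi i X &
    forall i X Y Z, nabla_phi g (s i) nabla X Y Z =
      half * beta * (eta i Y * g X Z - g X Y * eta i Z)].
Proof.
have T0form := sasaki_like_torsion_three_form.
have [nabla [nm tors nE]] := connection_of_torsion gm T0form.
have [lc [lcm lctors lcE]] := connection_of_torsion gm trivial_three_form.
have nabla_xi i X : nabla X (xi i) = (half * beta) *: phi i X.
  apply: (metric_inj gm) => Z; rewrite nE (koszul_xi (acm i))//.
  rewrite (form_skew12 T0form)// sasaki_like_torsion_xi !gE (metric_phi (acm i)).
  rewrite /theta /fundamental_form; ring.
have nabla_lc X Y Z : g (nabla X Y) Z = g (lc X Y) Z + half * T0 X Y Z.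
  by rewrite nE lcE; ring.
exists nabla; split=> //.
  have -> // : (fun X Y Z => g (torsion nabla X Y) Z) = T0.
  by apply/funext => X; apply/funext => Y; apply/funext => Z.
move=> i X Y Z; apply/eqP; rewrite -subr_eq0; apply/eqP; move: X Y Z.
have P1 := nabla_phi_lin1 (acm i) nm; have P2 := nabla_phi_lin2 (acm i) nm.
have PC := nabla_phi_skew (acm i) nm.
apply: (trilinear_vanish a3c).
- by move=> f X X' Y Z; rewrite P1 !gE; ring.
- by move=> f X Y Y' Z; rewrite P2 !gE (etaD (acm i)) (etaZ (acm i)); ring.
- by move=> X Y Z; rewrite (PC X Y Z); ring.
(* Vertical second argument: nabla xi is known, and products of the phi_i finish. *)
- move=> j X Z; rewrite (eta_xi a3c) (metric_xi (acm j)).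
  rewrite (nabla_phiE (acm i)) nabla_xi (phiZ (acm i)).
  have [->|ij] := eqVneq i j.
    have n0 : nabla X 0 = 0.
      have [[_ nadd _] _] := nm.
      by apply: (addrI (nabla X 0)); rewrite -nadd !addr0.
    rewrite (phi_xi (acm j)) n0 (acm_phi2 (acm j)) !gE (metric0l gm).
    by rewrite (metricC gm (xi j)) (metric_xi (acm j)) ?eqxx ?mulr1n; ring.
  have [e [k [p1 _ [-> _ e0] _ _]]] := phi_cross a3c ij.
  have -> : nabla X (e *: xi k) = e *: nabla X (xi k).
    by have [[_ _ ->] _] := nm; rewrite e0 scale0r add0r.
  rewrite nabla_xi p1 !gE (metricC gm (xi i)) (metric_xi (acm i)) ?mulr0n; ring.
(* Derivative along xi_j: nabla_{xi_j} W = nabla_W xi_j + [xi_j, W] + T(xi_j, W) brings in the Lie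
   derivative of phi_i. The result is A_ij corrected by a commutator of phi_i and phi_j, and the
   Reeb Killing condition makes the two cancel. *)
- move=> j Y Z HY HZ; rewrite (HY i) (HZ i) mulr0 mul0r subrr mulr0 subr0.
  have nxi W A : g (nabla (xi j) W) A =
      half * beta * g (phi j W) A + g [v xi j, W] A + theta j W A.
    by rewrite -sasaki_like_torsion_xi -tors /torsion !gE nabla_xi !gE; ring.
  have lie : g (lie_endo (xi j) (phi i) Y) Z =
      g [v xi j, phi i Y] Z + g [v xi j, Y] (phi i Z).
    by rewrite /lie_endo !gE (metric_phi (acm i)) opprK.
  have -> : nabla_phi g (s i) nabla (xi j) Y Z = A_tensor g s i j Y Z -
      half * beta * (g (phi j (phi i Y)) Z - g (phi i (phi j Y)) Z).
    set u := g (phi j (phi i Y)) Z; set v := g (phi i (phi j Y)) Z.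
    have uE : g (phi i Y) (phi j Z) = - u by rewrite /u (metric_phi (acm j)) opprK.
    have vE : g (phi j Y) (phi i Z) = - v by rewrite /v (metric_phi (acm i)) opprK.
    have vE' : g Y (phi j (phi i Z)) = v.
      by rewrite /v (metric_phi (acm i)) (metric_phi (acm j)) opprK.
    rewrite /nabla_phi !nxi /A_tensor lie /theta /fundamental_form uE vE vE' -/u.
    set R1 := (X in _ = X).
    (* [ring] does not know that half + half = 1, so the discrepancy is displayed as a multiple of
       half + half - 1. *)
    transitivity (R1 + (half + half - 1) * (beta * (u - v))); last first.
      by rewrite half_double subrr mul0r addr0.
    by rewrite /R1; ring.
  have [->|ij] := eqVneq i j.
    by have [-> _] := RK HY HZ; ring.
  have [e [k [p1 p2 _ _ AE]]] := phi_cross a3c ij.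
  rewrite (AE beta RK Y Z HY HZ) p1 p2 (HY i) (HY j) !scale0r !addr0 !gE.
  have -> : Phi k Y Z = - g (phi k Y) Z by rewrite (metric_phi (acm k)) opprK.
  transitivity ((half + half - 1) * (e * beta * g (phi k Y) Z)); first by ring.
  by rewrite half_double subrr mul0r.
(* Horizontal arguments: half of the Levi-Civita identity [horizontal_nabla_phi], with T/2
   accounting for the change of connection. *)
- move=> X Y Z HX HY HZ; rewrite (HY i) (HZ i) mulr0 mul0r subrr mulr0 subr0.
  have Hp := horizontal_phi a3c i.
  have := horizontal_nabla_phi (acm i) lcm (horizontal_phi a3c i) (fun X HX => HX i)
    lctors (canonical_N_skew can i) HX HY HZ.
  rewrite /= -!/(horizontal_torsion i _ _ _) /nabla_phi !nabla_lc.
  have HfY := Hp Y HY; have HfZ := Hp Z HZ.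
  rewrite !(sasaki_like_torsion_horizontal i)//.
  set p := g _ Z; set q := g _ (phi i Z) => E.
  transitivity (half * (p + q + (p + q) + horizontal_torsion i X (phi i Y) Z +
      horizontal_torsion i X Y (phi i Z)) + (1 - (half + half)) * (p + q)).
    by ring.
  by rewrite E half_double subrr mulr0 mul0r addr0.
Qed.

End Canonical.

Theorem theorem2p1p1 (R : realType) (n : nat) (M : smoothManifold R (4 * n + 3)%N)
    (g : vectorField M -> vectorField M -> smoothFun M)
    (s : 'I_3 -> contactData M)
    (M_almost_3_contact : almost_3_contact_metric g s)
    (M_canonical : canonical_3_contact g s) :
  (forall i : 'I_3, three_form (nijenhuis3 g (s i)) /\
                    admits_characteristic_connection g (s i)) /\
  (forall t : contactData M, associated_sphere s t ->
                    admits_characteristic_connection g t).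
Proof.
have acm i := a3c_acm M_almost_3_contact i; have gm := acm_metric (acm 0).
have [beta RK] := canonical_reeb_killing M_canonical.
have [nabla [nm skew nxi nphi]] := sasaki_like_connection M_almost_3_contact M_canonical RK.
split=> [i|t [a a1 ->]].
  have chari := characteristic_of_sasaki_like (acm i) nm skew (nxi i) (nphi i).
  split=> //; have [nabla' char'] := chari.
  exact: (nijenhuis_three_form (acm i) char').
apply: (characteristic_of_sasaki_like (sphere_acm M_almost_3_contact a1) nm skew
  (beta := beta)).
  move=> X; rewrite (sphere_nabla_xi s a X nm) /= scaler_sumr; apply: eq_bigr => i _.
  by rewrite nxi !scalerA mulrC.
move=> X Y Z; rewrite sphere_nabla_phi// /= !mulr_suml !mulr_sumr -sumrB mulr_sumr.
by apply: eq_bigr => i _; rewrite nphi; ring.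
Qed.
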